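(* Let $n\ge 1$. For every nonnesting matching $M\in \mathrm{NN}_{2n}$ and every noncrossing matching $M'\in \mathrm{NC}_{2n}$, the entry $a_{MM'}$ of the transition matrix from the Specht basis to the web basis of the Specht module $\mathcal{S}^{(n,n)}$ is equal to the number of web permutations $\sigma\in\mathfrak{S}_n$ such that $D(\sigma)\subseteq D(M)$ and $M(\sigma)=M'$.
   Context: **Matchings.** $[2n]=\{1,\dots,2n\}$; $\mathfrak{S}_m$ is the symmetric group on $[m]$. A matching on $[2n]$ is a set partition of $[2n]$ into blocks (arcs) of size 2; $\mathrm{Mat}_{2n}$ is the set of all of them. A matching is noncrossing if it has no two arcs $\{a,c\},\{b,d\}$ with $a<b<c<d$, and nonnesting if it has no two arcs $\{a,d\},\{b,c\}$ with $a<b<c<d$. $\mathrm{NC}_{2n}$ and $\mathrm{NN}_{2n}$ are the sets of noncrossing and nonnesting matchings on $[2n]$. For an arc $\{i,j\}$ with $i<j$, $i$ is called an opener and $j$ a closer. **Specht basis.** $\mathcal{S}^{(n,n)}$ is the (complex) Specht module of $\mathfrak{S}_{2n}$ indexed by the partition $(n,n)$, with its Specht basis $\{v_T\}$ of standard polytabloids, $T$ running over standard Young tableaux of shape $(n,n)$ (i.e. $2\times n$ arrays with entries $[2n]$, rows and columns increasing; $v_T=\sum_{\pi}\mathrm{sgn}(\pi)\{\pi T\}$, sum over the column stabilizer of $T$, where $\{\cdot\}$ denotes the row tabloid). Joining by an arc the two entries in each column of $T$ gives a bijection from these tableaux to $\mathrm{NN}_{2n}$; write $v_M:=v_T$ if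 $M\in\mathrm{NN}_{2n}$ corresponds to $T$. **Web basis.** Let $z=(z_{i,j})$ be a $2\times 2n$ matrix of indeterminates, $\Delta_{ij}=z_{1,i}z_{2,j}-z_{1,j}z_{2,i}$ for $1\le i<j\le 2n$, and $\Delta_M=\prod_{\{i,j\}\in M,\ i<j}\Delta_{ij}$ for $M\in\mathrm{Mat}_{2n}$. Let $W_n$ be the $\mathbb{C}$-span of all $\Delta_M$, $M\in \mathrm{Mat}_{2n}$. The set $\{\Delta_M: M\in\mathrm{NC}_{2n}\}$ is a basis of $W_n$ (the web basis). $\mathfrak{S}_{2n}$ acts on $W_n$ by permuting the columns of $z$, $\sigma\cdot\Delta_M(z)=\Delta_M(z\sigma^{-1})$ with $\sigma$ viewed as a permutation matrix (so that $\sigma\cdot\Delta_{ij}=\Delta_{\sigma(i)\sigma(j)}$, where $\Delta_{ji}=-\Delta_{ij}$), and $W_n\cong\mathcal{S}^{(n,n)}$ as $\mathfrak{S}_{2n}$-modules. Let $M_0=\{\{1,2\},\{3,4\},\dots,\{2n-1,2n\}\}$, let $\varphi:W_n\to\mathcal{S}^{(n,n)}$ be the unique $\mathfrak{S}_{2n}$-isomorphism with $\varphi(\Delta_{M_0})=v_{M_0}$, and put $w_{M'}=\varphi(\Delta_{M'})$ for $M'\in\mathrm{NC}_{2n}$. The numbers $a_{MM'}$ are defined by $v_M=\sum_{M'\in\mathrm{NC}_{2n}}a_{MM'}w_{M'}$ for $M\in\mathrm{NN}_{2n}$. **Dyck paths.** A Dyck path of length $2n$ is a lattice path from $(0,0)$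 to $(n,n)$ with $n$ north steps $\mathsf{N}=(0,1)$ and $n$ east steps $\mathsf{E}=(1,0)$ that does not go below the line $y=x$. Dyck paths are partially ordered by $\subseteq$, inclusion of the regions below the paths. For a matching $M$ on $[2n]$, $D(M)$ is the Dyck path obtained by reading $1,2,\dots,2n$ and recording $\mathsf{N}$ for each opener and $\mathsf{E}$ for each closer. **Cells.** In the $n\times n$ grid with corners $(0,0),(n,0),(0,n),(n,n)$, the cell $(i,j)$ is the unit cell whose upper-right corner is $(i,j)$. For $\sigma\in\mathfrak{S}_n$, $D(\sigma)$ is the minimum (with respect to $\subseteq$) Dyck path such that all cells $(i,\sigma(i))$, $1\le i\le n$, lie below the path. **Grid configurations.** For $\sigma\in\mathfrak{S}_n$, a cell $(i,j)$ is a crossing of $\sigma$ if $\sigma(i)<j$ and $i<\sigma^{-1}(j)$; $\mathrm{Cr}(\sigma)$ is the set of crossings. For $E\subseteq\mathrm{Cr}(\sigma)$, the grid configuration $G(\sigma,E)$ is the following drawing: mark each cell $(i,\sigma(i))$, and from the marked cell draw a horizontal line to the left boundary of the grid and a vertical line to the top boundary (so the strand turns at the marked cell); then in each cell of $E$ replace the crossing of a horizontal and a vertical line by an elbow, i.e. by one arc joining the midpoints of the left and bottom edges of the cell and one arc joining the midpoints of the right and top edges. Label the unit intervals of the left boundary $1,\dots,n$ from bottom to top and those of the top boundary $n+1,\dots,2n$ from left to right. Each strand joins two boundary intervals; $M(\sigma,E)$ is the matching on $[2n]$ whose arcs are the pairs of labels joined by strands. Put $M(\sigma):=M(\sigma,\mathrm{Cr}(\sigma))$,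 a noncrossing matching. **Web permutations.** Order cells by $(x,y)\succeq(x',y')$ iff $x\le x'$ and $y\ge y'$. The (remaining) crossings of $G(\sigma,E)$ are the elements of $\mathrm{Cr}(\sigma)\setminus E$. If $c=(i,j)$ is a $\succeq$-maximal remaining crossing of $G(\sigma,E)$, resolving $c$ produces two grid configurations: $G(\sigma,E\cup\{c\})$ (smoothing) and $G(\sigma',E)$ (switching), where $\sigma'(i)=j$, $\sigma'(\sigma^{-1}(j))=\sigma(i)$, and $\sigma'(k)=\sigma(k)$ for $k\ne i,\sigma^{-1}(j)$ (one has $E\subseteq\mathrm{Cr}(\sigma')$). Start from $G(\mathrm{id},\emptyset)$, $\mathrm{id}\in\mathfrak{S}_n$, and repeatedly replace each grid configuration having a remaining crossing by the two obtained by resolving a maximal one, until all are of the form $G(\sigma,\mathrm{Cr}(\sigma))$. The permutations $\sigma$ occurring are the web permutations of $[n]$ (the result does not depend on the choices of maximal crossings). *)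

(* Defs.v *)
From HB Require Import structures.
From mathcomp Require Import all_boot all_order all_fingroup all_algebra.
From mathcomp Require Import reals complex mpoly.

Set Implicit Arguments.
Unset Strict Implicit.
Unset Printing Implicit Defensive.

Import GRing.Theory.
Local Open Scope nat_scope.

(* The set [2n] is 'I_(n + n), shifted to start at 0: lshift and rshift then
   give the labels 1..n and n+1..2n. Cells, rows and columns are also numbered
   from 0. *)

Notation matching n := {set {set 'I_(n + n)}}.

Definition is_matching n (M : matching n) : bool :=
  partition M [set: 'I_(n + n)] && [forall B in M, #|B| == 2].

Definition noncrossing n (M : matching n) : bool :=
  is_matching M &&
  ~~ [exists a : 'I_(n + n), exists b : 'I_(n + n),
      exists c : 'I_(n + n), exists d : 'I_(n + n),
      [&& a < b, b < c, c < d, [set a; c] \in M & [set b; d] \in M]].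

Definition nonnesting n (M : matching n) : bool :=
  is_matching M &&
  ~~ [exists a : 'I_(n + n), exists b : 'I_(n + n),
      exists c : 'I_(n + n), exists d : 'I_(n + n),
      [&& a < b, b < c, c < d, [set a; d] \in M & [set b; c] \in M]].

Definition opener n (M : matching n) (i : 'I_(n + n)) : bool :=
  [exists j : 'I_(n + n), (i < j) && ([set i; j] \in M)].

(* {{1,2},{3,4},...,{2n-1,2n}} *)
Definition matching0 n : matching n :=
  [set B | [exists i : 'I_(n + n), exists j : 'I_(n + n),
            [&& ~~ odd i, j == i.+1 :> nat & B == [set i; j]]]].

Definition is_tableau n (T : 'M['I_(n + n)]_(2, n)) : bool :=
  injectiveb (fun c : 'I_2 * 'I_n => T c.1 c.2).

Definition is_standard n (T : 'M['I_(n + n)]_(2, n)) : bool :=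
  [&& is_tableau T,
      [forall r, forall j : 'I_n, forall k : 'I_n, (j < k) ==> (T r j < T r k)]
    & [forall j, T ord0 j < T ord_max j]].

(* A tabloid is recorded by the content of each of its rows. *)
Notation tabloid n := {ffun 'I_2 -> {set 'I_(n + n)}}.

Definition tabloid_of n (T : 'M['I_(n + n)]_(2, n)) : tabloid n :=
  [ffun r => [set T r j | j : 'I_n]].

Definition tabloid_act n (s : {perm 'I_(n + n)}) (t : tabloid n) : tabloid n :=
  [ffun r => s @: t r].

(* The ambient space has one coordinate for every pair of subsets of [2n]; only
   the coordinates at actual tabloids are nonzero on the Specht module. *)
Notation tabloid_space C n := {ffun tabloid n -> C^o}.

Definition tabloid_vec (C : fieldType) n (t : tabloid n) : tabloid_space C n :=
  [ffun u => (u == t)%:R%R].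

Definition space_act (C : fieldType) n (s : {perm 'I_(n + n)})
    (v : tabloid_space C n) : tabloid_space C n :=
  (\sum_t v t *: tabloid_vec C (tabloid_act s t))%R.

Definition column_stab n (T : 'M['I_(n + n)]_(2, n)) : {set {perm 'I_(n + n)}} :=
  [set s : {perm 'I_(n + n)} |
    [forall j, s @: [set T r j | r : 'I_2] == [set T r j | r : 'I_2]]].

Definition polytabloid (C : fieldType) n (T : 'M['I_(n + n)]_(2, n)) :
    tabloid_space C n :=
  (\sum_(s in column_stab T) (-1) ^+ s *: tabloid_vec C (tabloid_of (map_mx s T)))%R.

Definition specht_module (C : fieldType) n : {vspace tabloid_space C n} :=
  <<[seq polytabloid C T | T in @is_tableau n]>>%VS.

Definition matching_of_tableau n (T : 'M['I_(n + n)]_(2, n)) : matching n :=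
  [set [set T r j | r : 'I_2] | j : 'I_n].

(* v_M; the value 0 is never used when M is nonnesting. *)
Definition specht_vec (C : fieldType) n (M : matching n) : tabloid_space C n :=
  if [pick T | is_standard T && (matching_of_tableau T == M)] is Some T
  then polytabloid C T else 0%R.

Notation web_ring C n := {mpoly C[2 * (n + n)]}.

Definition zmat (C : fieldType) n : 'M[web_ring C n]_(2, n + n) :=
  (\matrix_(r, i) 'X_(mxvec_index r i))%R.

Definition Delta_arc (C : fieldType) n (i j : 'I_(n + n)) : web_ring C n :=
  (zmat C n ord0 i * zmat C n ord_max j - zmat C n ord0 j * zmat C n ord_max i)%R.

Definition Delta (C : fieldType) n (M : matching n) : web_ring C n :=
  (\prod_(p : 'I_(n + n) * 'I_(n + n) | (p.1 < p.2)%N && ([set p.1; p.2] \in M))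
     Delta_arc C p.1 p.2)%R.

Definition in_web_module (C : fieldType) n (p : web_ring C n) : Prop :=
  exists c : matching n -> C,
    p = (\sum_(M : matching n | is_matching M) c M *: Delta C M)%R.

(* Substitutes z_(r,s(i)) for z_(r,i), i.e. evaluates p at
   col_perm s z = z *m perm_mx s^-1 (lemma col_permE). *)
Definition web_act (C : fieldType) n (s : {perm 'I_(n + n)}) (p : web_ring C n) :
    web_ring C n :=
  p \mPo [tuple mxvec (col_perm s (zmat C n)) ord0 k | k < 2 * (n + n)].

(* phi is only constrained on the web module. *)
Record is_web_specht_iso (C : fieldType) n
    (phi : web_ring C n -> tabloid_space C n) : Prop := IsWebSpechtIso {
  iso_linear : forall (c : C) p q, in_web_module p -> in_web_module q ->
    phi (c *: p + q)%R = (c *: phi p + phi q)%R;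
  iso_into : forall p, in_web_module p -> phi p \in specht_module C n;
  iso_inj : forall p q, in_web_module p -> in_web_module q ->
    phi p = phi q -> p = q;
  iso_onto : forall v, v \in specht_module C n ->
    exists2 p, in_web_module p & phi p = v;
  iso_equivariant : forall s p, in_web_module p ->
    phi (web_act s p) = space_act s (phi p);
  iso_normalized : phi (Delta C (matching0 n)) = specht_vec C (matching0 n) }.

(* A path is a word, with true for a north step and false for an east step. *)

Definition is_dyck n (P : (n + n).-tuple bool) : bool :=
  (count id P == n) &&
  [forall k : 'I_(n + n).+1, count negb (take k P) <= count id (take k P)].

Notation cell n := ('I_n * 'I_n)%type.

(* Cell c is below P iff the east step of P in column c.1 has height > c.2. *)
Definition region_below n (P : (n + n).-tuple bool) : {set cell n} :=
  [set c : cell n | [exists k : 'I_(n + n),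
     [&& ~~ tnth P k, count negb (take k P) == c.1 & c.2 < count id (take k P)]]].

Definition dyck_sub n (P Q : (n + n).-tuple bool) : bool :=
  region_below P \subset region_below Q.

Definition dyck_of_matching n (M : matching n) : (n + n).-tuple bool :=
  [tuple opener M i | i < n + n].

Definition dyck_covers n (s : {perm 'I_n}) (P : (n + n).-tuple bool) : bool :=
  is_dyck P && [forall i, (i, s i) \in region_below P].

(* The minimum exists, so the default value is never used. *)
Definition dyck_of_perm n (s : {perm 'I_n}) : (n + n).-tuple bool :=
  odflt [tuple true | _ < n + n]
    [pick P | dyck_covers s P &&
              [forall Q : (n + n).-tuple bool, dyck_covers s Q ==> dyck_sub P Q]].

Definition crossings n (s : {perm 'I_n}) : {set cell n} :=
  [set c : cell n | (s c.1 < c.2) && (c.1 < (s^-1)%g c.2)].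

(* Midpoints of the unit edges of the grid: inl (x, j) is on the vertical edge
   of abscissa x in row j, inr (i, y) on the horizontal edge of height y in
   column i. *)
Notation edge n := ('I_n.+1 * 'I_n + 'I_n * 'I_n.+1)%type.

Definition left_edge n (c : cell n) : edge n := inl (widen_ord (leqnSn n) c.1, c.2).
Definition right_edge n (c : cell n) : edge n := inl (lift ord0 c.1, c.2).
Definition bottom_edge n (c : cell n) : edge n := inr (c.1, widen_ord (leqnSn n) c.2).
Definition top_edge n (c : cell n) : edge n := inr (c.1, lift ord0 c.2).

(* Pieces of strands inside cell c of G(s, E): the turn at a marked cell, the two
   arcs of an elbow, a horizontal segment, a vertical segment. *)
Definition cell_arc n (s : {perm 'I_n}) (E : {set cell n}) (c : cell n) :
    rel (edge n) :=
  fun u v =>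
  [|| [&& c.2 == s c.1, u == left_edge c & v == top_edge c],
      [&& c \in E, u == left_edge c & v == bottom_edge c],
      [&& c \in E, u == right_edge c & v == top_edge c],
      [&& c \notin E, c.1 < (s^-1)%g c.2, u == left_edge c & v == right_edge c]
    | [&& c \notin E, s c.1 < c.2, u == bottom_edge c & v == top_edge c]].

Definition strand_rel n (s : {perm 'I_n}) (E : {set cell n}) : rel (edge n) :=
  fun u v => [exists c, cell_arc s E c u v || cell_arc s E c v u].

Definition boundary_edge n (p : 'I_(n + n)) : edge n :=
  match split p with
  | inl j => inl (ord0, j)
  | inr i => inr (i, ord_max)
  end.

Definition grid_matching n (s : {perm 'I_n}) (E : {set cell n}) : matching n :=
  [set B | [exists p : 'I_(n + n), exists q : 'I_(n + n),
     [&& p != q, connect (strand_rel s E) (boundary_edge p) (boundary_edge q)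
       & B == [set p; q]]]].

Definition matching_of_perm n (s : {perm 'I_n}) : matching n :=
  grid_matching s (crossings s).

Definition cell_ge n (c d : cell n) : bool := (c.1 <= d.1) && (d.2 <= c.2).

Definition max_remaining n (s : {perm 'I_n}) (E : {set cell n}) (c : cell n) : bool :=
  (c \in crossings s :\: E) &&
  [forall d in crossings s :\: E, cell_ge d c ==> (d == c)].

(* perm multiplication applies its left factor first, so this permutation sends
   c.1 to c.2 and s^-1 c.2 to s c.1. *)
Definition switch n (s : {perm 'I_n}) (c : cell n) : {perm 'I_n} :=
  (tperm c.1 ((s^-1)%g c.2) * s)%g.

Definition resolve n : rel ({perm 'I_n} * {set cell n}) :=
  fun G H => [exists c, max_remaining G.1 G.2 c &&
    ((H == (G.1, c |: G.2)) || (H == (switch G.1 c, G.2)))].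

Definition web_perm n (s : {perm 'I_n}) : bool :=
  connect (@resolve n) (1%g, set0) (s, crossings s).

(* Main.v *)
(** The polytabloid $v_M$ is the image of $v_{M_0}$ under a permutation carrying
    $M_0$ to $M$ arc by arc, so equivariance gives $v_M = \varphi(\Delta_M)$, and $a_{MM'}$ are the coefficients of $\Delta_M$
    in the web basis.

    Draw $M$ as $G(\mathrm{id}, E)$ with $E$ the set of all cells above $D(M)$.
    Resolving a maximal crossing is the Pluecker relation, so $\Delta_M$ is the sum of
    $\Delta_{M(\sigma)}$ over the leaves $\sigma$ reached from $(\mathrm{id}, E)$. A
    leaf below a smoothing of $c$ still has $c$ as a crossing and a leaf below a
    switch at $c$ is marked at $c$: hence every leaf is reached once, and the leaves
    from $(\mathrm{id}, E)$ are the web permutations with no mark in $E$, i.e. with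
    $D(\sigma) \subseteq D(M)$.

    Each $M(\sigma)$ is noncrossing because two strands of a fully smoothed
    configuration never meet, and the noncrossing $\Delta_{M'}$ are independent
    because they are triangular when evaluated at the 0-1 matrices given by the
    openers of noncrossing matchings. *)

(* Web permutations are defined by arbitrary choices of maximal crossings, whereas the count splits
   at a chosen one. Confluence reconciles the two, and it lets the configurations [(id, E)] and
   [(id, set0)] be compared by resolving the cells of [E] first.

   A resolution becomes a Pluecker relation because the smoothed cells stay up-closed among the
   crossings: below and to the right of a maximal crossing there is no elbow. Prolong every strand
   beyond its mark, to the right and bottom sides of the grid. This gives [2n] walks whose ends
   depend on [E] alone, while the permutation only tells which row walk is joined to which column
   walk. A smoothing then composes the map of ends with a transposition, a switch composes the
   permutation with one, and all factors but two are unchanged. *)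
Require Import Defs.
From mathcomp Require Import all_boot all_order all_fingroup all_algebra.
From mathcomp Require Import reals complex mpoly zify ring.

Set Implicit Arguments.
Unset Strict Implicit.
Unset Printing Implicit Defensive.

Import GRing.Theory.
Local Open Scope nat_scope.

(** * Confluence of the resolution of crossings *)

Section Resolution.

Variable n : nat.
Implicit Types (s t : {perm 'I_n}) (c d e : cell n) (E : {set cell n}).

Lemma cell_ge_refl c : cell_ge c c.
Proof. by rewrite /cell_ge !leqnn. Qed.

Lemma cell_ge_trans c d e : cell_ge c d -> cell_ge d e -> cell_ge c e.
Proof. rewrite /cell_ge; lia. Qed.

Lemma cell_ge_anti c d : cell_ge c d -> cell_ge d c -> c = d.
Proof.
case: c d => [i j] [i' j']; rewrite /cell_ge /= => h1 h2.
by congr pair; apply: val_inj => /=; lia.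
Qed.

Lemma exists_max_cell (A : {set cell n}) : A != set0 ->
  exists2 c, c \in A & forall d, d \in A -> cell_ge d c -> d = c.
Proof.
case/set0Pn => c0 c0A.
(* The weight [c.2 + (n - c.1)] increases strictly along [cell_ge], so a cell maximising it is
   maximal. *)
case: (@arg_maxnP _ c0 (mem A) (fun c : cell n => c.2 + (n - c.1)) c0A) => c cA cmax.
exists c => // -[i j] dA; have := cmax _ dA; case: c cA cmax => i' j' _ _.
rewrite /cell_ge /= => h1 h2; have := ltn_ord i; have := ltn_ord i' => h3 h4.
by congr pair; apply: val_inj => /=; lia.
Qed.

Lemma switchE s c i :
  switch s c i = if i == c.1 then c.2 else if s i == c.2 then s c.1 else s i.
Proof.
rewrite /switch permM; case: tpermP => [->|->|/eqP i1 /eqP i2].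
- by rewrite eqxx permKV.
- by rewrite permKV eqxx; case: eqP => // <-; rewrite permKV.
- by rewrite (negPf i1) (canF_eq (permK s)) (negPf i2).
Qed.

Lemma switchVE s c j :
  (switch s c)^-1%g j =
  if j == c.2 then c.1 else if j == s c.1 then s^-1%g c.2 else s^-1%g j.
Proof.
apply: (canLR (permK _)); rewrite switchE.
have [->|j1] := eqVneq j c.2; first by rewrite eqxx.
have [->|j2] := eqVneq j (s c.1).
  case: eqP => [e|_]; first by rewrite -e permKV.
  by rewrite permKV eqxx.
rewrite permKV (negPf j1); case: eqP => // e.
by case/eqP: j2; rewrite -e permKV.
Qed.

(* A switch at [c] only affects crossings in the rectangle spanned by the two
   marks it moves, all of whose cells are [<= c]. *)
Lemma crossings_switch s c d : c \in crossings s -> ~~ cell_ge c d ->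
  (d \in crossings (switch s c)) = (d \in crossings s).
Proof.
case: c d => [i j] [x y]; rewrite !inE /cell_ge /= => /andP[h1 h2] h3.
rewrite switchE switchVE /=.
have [xi|xi] := eqVneq x i.
  subst x.
  have -> : (y == j) = false by apply/eqP => e; subst; lia.
  have -> : (y == s i) = false by apply/eqP => e; subst; lia.
  lia.
have [sx|sxj] := eqVneq (s x) j.
  have -> : (y == j) = false.
    by apply/eqP => e; move: h2 h3; rewrite e -sx permK; lia.
  have ex : s^-1%g j = x by rewrite -sx permK.
  have -> : (y == s i) = false by apply/eqP => e; subst; rewrite permK in h2; lia.
  by rewrite ex in h2; rewrite sx; lia.
have [yj|yj] := eqVneq y j; first by subst; lia.
by have [ys|//] := eqVneq y (s i); subst y; rewrite permK; lia.
Qed.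

(** Incomparable crossings lie in different rows and columns, so both orders leave marks at [c] and
    [d]. The switches may move a common mark, when [s c.1 = d.2] or [s d.1 = c.2]; the displaced
    value then ends in the same column in both orders. *)
Lemma switchC s c d : c \in crossings s -> d \in crossings s ->
  ~~ cell_ge c d -> ~~ cell_ge d c ->
  switch (switch s c) d = switch (switch s d) c.
Proof.
case: c d => [i j] [i' j']; rewrite !inE /cell_ge /= => /andP[h1 h2] /andP[h1' h2'] h3 h4.
have ii : i != i' by apply/eqP => e; subst; lia.
have jj : j != j' by apply/eqP => e; subst; lia.
apply/permP => x; rewrite !switchE /=.
have [->|xi] := eqVneq x i.
  by rewrite (negPf ii) (negPf jj).
have [_|xi'] := eqVneq x i'.
  by rewrite eq_sym (negPf jj).
rewrite (negPf ii) [i' == i]eq_sym (negPf ii).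
have [sx|sx] := eqVneq (s x) j.
  have -> : (s x == j') = false by rewrite sx (negPf jj).
  rewrite sx eqxx; case: (eqVneq (s i) j') => // e.
  by case: eqP => // e'; case/eqP: xi'; apply: (@perm_inj _ s); rewrite sx e'.
have [sx'|sx'] := eqVneq (s x) j'; last by rewrite (negPf sx).
case: (eqVneq (s i') j) => // e.
by case: eqP => // e'; case/eqP: xi; apply: (@perm_inj _ s); rewrite sx' e'.
Qed.

Lemma max_remainingP s E c :
  reflect [/\ c \in crossings s, c \notin E &
             forall d, d \in crossings s -> d \notin E -> cell_ge d c -> d = c]
          (max_remaining s E c).
Proof.
apply: (iffP andP) => [[]|[cs cE H]].
  rewrite inE => /andP[cE cs] /forall_inP H; split=> // d ds dE dc.
  by apply/eqP; apply: (implyP (H d _)) => //; rewrite inE dE.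
split; first by rewrite inE cE.
apply/forall_inP => d; rewrite inE => /andP[dE ds]; apply/implyP => dc.
by apply/eqP; exact: H.
Qed.

Lemma max_remaining_incomparable s E c d :
  max_remaining s E c -> max_remaining s E d -> c != d -> ~~ cell_ge c d.
Proof.
case/max_remainingP => cs cE _ /max_remainingP[_ _ H] /eqP cd.
by apply/negP => /(H _ cs cE).
Qed.

Lemma max_remaining_smooth s E c d :
  max_remaining s E c -> max_remaining s E d -> c != d ->
  max_remaining s (c |: E) d.
Proof.
case/max_remainingP => cs cE Hc /max_remainingP[ds dE Hd] cd.
apply/max_remainingP; split=> //; first by rewrite !inE negb_or dE eq_sym cd.
by move=> e es; rewrite !inE negb_or => /andP[_ eE]; exact: Hd.
Qed.

Lemma max_remaining_switch s E c d :
  max_remaining s E c -> max_remaining s E d -> c != d ->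
  max_remaining (switch s c) E d.
Proof.
move=> cm dm cd; have cNd := max_remaining_incomparable cm dm cd.
case/max_remainingP: cm dm => cs cE Hc /max_remainingP[ds dE Hd].
apply/max_remainingP; split=> //; first by rewrite crossings_switch.
move=> e es eE ed; apply: Hd => //; rewrite -(crossings_switch cs) //.
by apply: contra cNd => ce; exact: cell_ge_trans ce ed.
Qed.

Lemma resolveP s E H : reflect (exists2 c, max_remaining s E c &
    H = (s, c |: E) \/ H = (switch s c, E)) (resolve (s, E) H).
Proof.
apply: (iffP existsP) => [[c /andP[cm /orP[]/eqP->]]|[c cm [->|->]]].
- by exists c => //; left.
- by exists c => //; right.
- by exists c; rewrite cm eqxx.
- by exists c; rewrite cm eqxx orbT.
Qed.

(* The cells that can still change: every remaining crossing of a later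
   configuration lies below a remaining crossing of the present one. *)
Definition active s E : {set cell n} :=
  [set d | [exists c in crossings s :\: E, cell_ge c d]].

Lemma activeP s E d : reflect (exists c, [/\ c \in crossings s, c \notin E & cell_ge c d])
  (d \in active s E).
Proof.
rewrite inE; apply: (iffP existsP) => -[c].
  by rewrite inE => /andP[/andP[cE cs] cd]; exists c.
by case=> cs cE cd; exists c; rewrite inE cE cs.
Qed.

Lemma active_smooth s E c : active s (c |: E) \subset active s E.
Proof.
apply/subsetP => d /activeP[e [es]]; rewrite in_setU1 negb_or => /andP[_ eE] ed.
by apply/activeP; exists e.
Qed.

Lemma active_switch s E c : c \in crossings s -> c \notin E ->
  active (switch s c) E \subset active s E.
Proof.
move=> cs cE; apply/subsetP => d /activeP[e [es eE ed]]; apply/activeP.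
case: (boolP (cell_ge c e)) => ce.
  by exists c; split=> //; exact: cell_ge_trans ce ed.
by exists e; rewrite -(crossings_switch cs).
Qed.

Lemma not_active_smooth s E c : max_remaining s E c -> c \notin active s (c |: E).
Proof.
case/max_remainingP => cs cE Hc; apply/negP => /activeP[e [es]].
by rewrite !inE negb_or => /andP[ec eE] /(Hc _ es eE)/eqP; rewrite (negPf ec).
Qed.

(** After the switch [c] is marked, hence no crossing; a crossing strictly above [c] in the order is
    untouched by the switch and would contradict maximality. *)
Lemma not_active_switch s E c : max_remaining s E c ->
  c \notin active (switch s c) E.
Proof.
case/max_remainingP => cs cE Hc; apply/negP => /activeP[e [es eE ec]].
case: (boolP (cell_ge c e)) => ce.
  by move: es; rewrite (cell_ge_anti ec ce) inE switchE eqxx ltnn.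
have := ce; rewrite (Hc e) ?cell_ge_refl // -(crossings_switch cs) //.
Qed.

Lemma active_max s E c : max_remaining s E c -> c \in active s E.
Proof.
by case/max_remainingP=> cs cE _; apply/activeP; exists c; rewrite cell_ge_refl.
Qed.

Lemma active_resolve s E t F : resolve (s, E) (t, F) ->
  active t F \proper active s E.
Proof.
case/resolveP => c cm; have ca := active_max cm.
have [cs cE _] := max_remainingP _ _ _ cm.
case=> [] [-> ->]; apply/properP; split; rewrite ?active_smooth ?active_switch //.
  by exists c => //; exact: not_active_smooth.
by exists c => //; exact: not_active_switch.
Qed.

(** [E] is an up-set among the crossings, as happens when they are smoothed from the maximal ones
    downwards. This invariant keeps elbows away from the cells below a crossing still to be
    resolved. *)
Definition smoothing_closed s E :=
  E \subset crossings s /\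
  forall c d, d \in E -> c \in crossings s -> cell_ge c d -> c \in E.

Lemma smoothing_closed_smooth s E c : smoothing_closed s E ->
  max_remaining s E c -> smoothing_closed s (c |: E).
Proof.
move=> [sub up] /max_remainingP[cs cE Hc]; split.
  by rewrite subUset sub1set cs.
move=> d e; rewrite !in_setU1 => /predU1P[->|eE] ds de; last by rewrite (up d e) ?orbT.
by have [//|dE] := boolP (d \in E); rewrite ?orbT // (Hc d) ?eqxx.
Qed.

Lemma smoothing_closed_switch s E c : smoothing_closed s E ->
  max_remaining s E c -> smoothing_closed (switch s c) E.
Proof.
move=> [sub up] /max_remainingP[cs cE Hc].
have nge d : d \in E -> ~~ cell_ge c d.
  by move=> dE; apply: contra cE; exact: up.
split.
  by apply/subsetP => d dE; rewrite crossings_switch ?nge // (subsetP sub).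
move=> d e eE ds de; apply: (up d e) => //.
rewrite -(crossings_switch cs) //.
by apply: contra (nge _ eE) => cd; exact: cell_ge_trans cd de.
Qed.

Definition leaf s E t := connect (@resolve n) (s, E) (t, crossings t).

Lemma leaf_ind (P : {perm 'I_n} -> {set cell n} -> Prop) t :
    (forall s E, P s E -> forall s' E', resolve (s, E) (s', E') -> P s' E') ->
  forall s E, P s E -> leaf s E t -> P t (crossings t).
Proof.
move=> step s E PsE /connectP[p].
elim: p s E PsE => [|[s' E'] p IHp] s E PsE /=; first by move=> _ [-> ->].
case/andP => r pth lst; exact: (IHp s' E' (step _ _ PsE _ _ r)).
Qed.

Lemma leaf_first s E t : leaf s E t ->
  (s, E) = (t, crossings t) \/ exists s' E', resolve (s, E) (s', E') /\ leaf s' E' t.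
Proof.
case/connectP => -[|[s' E'] p] /=; first by left.
case/andP => r pth lst; right; exists s', E'; split=> //.
by apply/connectP; exists p.
Qed.

Lemma max_remaining_irrefl t c : ~~ max_remaining t (crossings t) c.
Proof. by apply/negP => /max_remainingP[ct]; rewrite ct. Qed.

Lemma leaf_cons s E s' E' t : resolve (s, E) (s', E') -> leaf s' E' t -> leaf s E t.
Proof. by move=> r; apply: connect_trans; exact: connect1. Qed.

(* Confluence: two maximal crossings are incomparable, and resolving them in
   either order gives the same configurations. *)
Lemma leaf_resolve s E c t : max_remaining s E c ->
  leaf s E t = leaf s (c |: E) t || leaf (switch s c) E t.
Proof.
move=> cm; apply/idP/orP; last first.
  by case; apply: leaf_cons; apply/resolveP; exists c => //; [left|right].
have [k] := ubnP #|active s E|.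
elim: k s E c cm => // k IHk s E c cm ak /leaf_first[[e1 e2]|].
  by move: cm; rewrite e1 e2 (negPf (max_remaining_irrefl _ _)).
case=> s' [E' [r lf]].
have/proper_card ak' := active_resolve r.
(* [c] remains maximal after a first step at another cell [d], so the induction hypothesis splits
   the rest of the path at [c]; the step at [d] is then replayed after the one at [c]. *)
have {}IHk : max_remaining s' E' c -> leaf s' (c |: E') t \/ leaf (switch s' c) E' t.
  by move=> cm'; apply: IHk lf => //; lia.
case/resolveP: r ak' lf => d dm.
have [->|dc] := eqVneq d c.
  by case=> [] [-> ->]; [left|right].
have [cs cE _] := max_remainingP _ _ _ cm; have [ds dE _] := max_remainingP _ _ _ dm.
have cd : c != d by rewrite eq_sym.
case=> [] [e1 e2] _ _; rewrite e1 e2 in IHk.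
  case: IHk => [||lf]; first exact: max_remaining_smooth.
    rewrite setUCA => lf; left; apply: leaf_cons lf.
    by apply/resolveP; exists d; [exact: max_remaining_smooth|left].
  right; apply: leaf_cons lf; apply/resolveP.
  by exists d; [exact: max_remaining_switch|left].
case: IHk => [|lf|lf]; first exact: max_remaining_switch.
  left; apply: leaf_cons lf; apply/resolveP.
  by exists d; [exact: max_remaining_smooth|right].
right; apply: leaf_cons lf; apply/resolveP.
exists d; first exact: max_remaining_switch.
right; congr pair; apply: switchC => //.
  exact: max_remaining_incomparable dm cm dc.
exact: max_remaining_incomparable cm dm cd.
Qed.

Lemma leaf_sub_crossings s E t : smoothing_closed s E -> leaf s E t ->
  E \subset crossings t.
Proof.
move=> sc; apply: (@leaf_ind (fun s' E' => E \subset E')) => // s1 E1 sub s2 E2.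
case/resolveP => c _ [] [_ ->] //.
by apply: subset_trans sub _; exact: subsetUr.
Qed.

(** A switch at [d] moves the marks of column [d.1] and row [d.2]; both lie below [d] in the order,
    hence are active. A mark outside the active cells is therefore final. *)
Lemma leaf_mark s E t c : c \notin active s E -> s c.1 = c.2 -> leaf s E t ->
  t c.1 = c.2.
Proof.
move=> ca sc lf.
suff [] : c \notin active t (crossings t) /\ t c.1 = c.2 by [].
apply: (leaf_ind (P := fun s E => c \notin active s E /\ s c.1 = c.2)) lf => //.
move=> {sc ca E} {}s E [ca sc] s' E' r; split.
  by apply: contra ca; apply/subsetP; case/properP: (active_resolve r).
case/resolveP: r => d dm [] [-> _] //; rewrite switchE.
have {dm} [ds dE _] := max_remainingP _ _ _ dm.
have nge : ~~ cell_ge d c by apply: contra ca => dc; apply/activeP; exists d.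
move: ds; rewrite inE => /andP[ds1 ds2].
have [e|_] := eqVneq c.1 d.1.
  by move: nge; rewrite /cell_ge -sc e; lia.
have [e|//] := eqVneq (s c.1) d.2.
move: nge; rewrite /cell_ge -sc e; move: ds2; rewrite -e permK; lia.
Qed.

Lemma leaf_disjoint s E c t : smoothing_closed s E -> max_remaining s E c ->
  leaf s (c |: E) t -> leaf (switch s c) E t -> False.
Proof.
move=> sc cm lf1 lf2.
have := leaf_mark (not_active_switch cm) _ lf2; rewrite switchE eqxx => /(_ erefl) tc.
have/subsetP/(_ c) := leaf_sub_crossings (smoothing_closed_smooth sc cm) lf1.
by rewrite setU11 inE tc ltnn => /(_ isT).
Qed.

Lemma leaf_final t t' : leaf t (crossings t) t' = (t' == t).
Proof.
apply/idP/eqP => [/leaf_first[[]|[s' [E' [/resolveP[c]]]]]|->]; rewrite ?/leaf //.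
by rewrite (negPf (max_remaining_irrefl _ _)).
Qed.

Lemma exists_max_remaining s E : crossings s :\: E != set0 ->
  exists c, max_remaining s E c.
Proof.
case/exists_max_cell => c; rewrite inE => /andP[cE cs] H; exists c.
by apply/max_remainingP; split=> // d ds dE; apply: H; rewrite inE dE.
Qed.

(** Smoothing [E0] in advance prunes the resolution tree. A maximal cell [c] of [E0 :\: E] is a
    maximal remaining crossing: the leaves below its switch are marked at [c] and are the ones lost,
    and the induction continues with [c] added to [E]. *)
Lemma leaf_smoothing_closed s E E0 t :
  smoothing_closed s E -> smoothing_closed s E0 -> E \subset E0 ->
  leaf s E0 t = leaf s E t && [forall i, (i, t i) \notin E0].
Proof.
move=> + sc0; have [k] := ubnP #|E0 :\: E|; elim: k E => // k IHk E Ek sc sub.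
have [e|] := eqVneq (E0 :\: E) set0.
  have -> : E = E0 by apply/eqP; rewrite eqEsubset sub -setD_eq0 e /=.
  case: (boolP (leaf s E0 t)) => //= lf; symmetry; apply/forallP => i.
  apply/negP => /(subsetP (leaf_sub_crossings sc0 lf)).
  by rewrite inE ltnn.
case/exists_max_cell => c; rewrite inE => /andP[cE c0] H.
have cs : c \in crossings s by case: sc0 => /subsetP /(_ _ c0).
have cm : max_remaining s E c.
  apply/max_remainingP; split=> // d ds dE dc; apply: H => //.
  by rewrite inE dE; case: sc0 => _ up0; exact: up0 c0 ds dc.
rewrite (leaf_resolve _ cm) (IHk (c |: E)).
- rewrite andb_orl; case: (leaf (switch s c) E t) / boolP => lf; last by rewrite orbF.
  have := leaf_mark (not_active_switch cm) _ lf; rewrite switchE eqxx => /(_ erefl) tc.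
  have -> : [forall i, (i, t i) \notin E0] = false.
    by apply/negP => /forallP /(_ c.1); rewrite tc -surjective_pairing c0.
  by rewrite !andbF.
- rewrite -ltnS; apply: leq_trans Ek; rewrite ltnS.
  apply: proper_card; apply/properP; split.
    by apply: setDS; exact: subsetUr.
  by exists c; rewrite !inE ?eqxx ?cE.
- exact: smoothing_closed_smooth.
- by rewrite subUset sub1set c0.
Qed.

(** By [leaf_resolve] and [leaf_disjoint], the leaves of a configuration are the disjoint union of
    those of its two resolutions, so a function additive under resolution unrolls to a sum over
    leaves. *)
Lemma leaf_sum (V : nmodType) (inv : {perm 'I_n} -> {set cell n} -> Prop)
    (F : {perm 'I_n} -> {set cell n} -> V) :
    (forall s E, inv s E -> smoothing_closed s E) ->
    (forall s E c, inv s E -> max_remaining s E c ->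
      [/\ inv s (c |: E), inv (switch s c) E &
          F s E = F s (c |: E) + F (switch s c) E]%R) ->
  forall s E, inv s E -> F s E = (\sum_(t | leaf s E t) F t (crossings t))%R.
Proof.
move=> inv_sc step s E; have [k] := ubnP #|active s E|.
elim: k s E => // k IHk s E ak i; have sc := inv_sc _ _ i.
have [e|/exists_max_remaining[c cm]] := eqVneq (crossings s :\: E) set0.
  have -> : E = crossings s.
    by case: sc => sub _; apply/eqP; rewrite eqEsubset sub -setD_eq0 e /=.
  by under eq_bigl do rewrite leaf_final; rewrite big_pred1_eq.
have [i1 i2 ->] := step _ _ _ i cm.
have r1 : resolve (s, E) (s, c |: E) by apply/resolveP; exists c => //; left.
have r2 : resolve (s, E) (switch s c, E) by apply/resolveP; exists c => //; right.
have/proper_card a1 := active_resolve r1; have/proper_card a2 := active_resolve r2.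
rewrite (IHk _ _ _ i1) ?(IHk _ _ _ i2); try lia.
under [RHS]eq_bigl do rewrite (leaf_resolve _ cm).
rewrite [RHS](bigID (leaf s (c |: E))) /=; congr (_ + _)%R; apply: eq_bigl => t.
  by case: (leaf s (c |: E) t); rewrite ?andbT ?andbF.
case: (boolP (leaf s (c |: E) t)) => lf; rewrite ?andbT ?andbF //=.
by apply/negP; exact: leaf_disjoint lf.
Qed.

End Resolution.

(** * Strands of a grid configuration *)

Section Walks.

Variable n : nat.
Implicit Types (s t : {perm 'I_n}) (c d : cell n) (E : {set cell n}) (e f : edge n).

(* Strands are followed leftwards and upwards; such a walk depends on [E] only
   and stays put once it has reached the left or top boundary. *)
Definition walk_step E e : edge n :=
  match e with
  | inl (x, j) =>
      if unlift ord0 x is Some i then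
        if (i, j) \in E then top_edge (i, j) else left_edge (i, j)
      else e
  | inr (i, y) =>
      if unlift ord_max y is Some j then
        if (i, j) \in E then left_edge (i, j) else top_edge (i, j)
      else e
  end.

Definition on_boundary e : bool :=
  match e with inl (x, _) => x == 0 :> nat | inr (_, y) => y == n :> nat end.

Definition edge_label e : 'I_(n + n) :=
  match e with inl (_, j) => lshift n j | inr (i, _) => rshift n i end.

(** [n + n] steps reach the boundary: [edge_diag] is positive, at most [n + n], and drops at every
    step inside the grid. *)
Definition exit E e : 'I_(n + n) := edge_label (iter (n + n) (walk_step E) e).

(* Number of the edge [e] on any lattice path from [(0,0)] to [(n,n)] through [e]. *)
Definition edge_pos e : nat :=
  match e with inl (x, j) => x + j | inr (i, y) => i + y end.

(* Constant on the edges entering a diagonal of cells; it decreases by one at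
   every step of a walk inside the grid. *)
Definition edge_diag e : nat :=
  match e with inl (x, j) => x + (n - j) | inr (i, y) => i.+1 + (n - y) end.

Lemma bottom_edgeE c : bottom_edge c = inr (c.1, lift ord_max c.2).
Proof. by congr (inr (_, _)); exact/val_inj/esym/lift_max. Qed.

Lemma walk_right E c :
  walk_step E (right_edge c) = if c \in E then top_edge c else left_edge c.
Proof. by case: c => i j; rewrite /walk_step /right_edge liftK. Qed.

Lemma walk_bottom E c :
  walk_step E (bottom_edge c) = if c \in E then left_edge c else top_edge c.
Proof. by rewrite bottom_edgeE; case: c => i j; rewrite /walk_step liftK. Qed.

Lemma walk_boundary E e : on_boundary e -> walk_step E e = e.
Proof.
case: e => [[x j]|[i y]] /eqP /= h.
  by have -> : x = ord0 by [exact: val_inj]; rewrite unlift_none.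
by have -> : y = ord_max by [exact: val_inj]; rewrite unlift_none.
Qed.

Lemma edgeP e : [\/ on_boundary e, exists c, e = right_edge c | exists c, e = bottom_edge c].
Proof.
case: e => [[x j]|[i y]] /=.
  have [i ->|->] := unliftP ord0 x; last by constructor 1.
  by constructor 2; exists (i, j).
have [j ->|->] := unliftP ord_max y; last by constructor 1.
by constructor 3; exists (i, j); rewrite bottom_edgeE.
Qed.

Lemma boundary_edgeP e : on_boundary e -> e = boundary_edge (edge_label e).
Proof.
case: e => [[x j]|[i y]] /eqP /= h; rewrite /boundary_edge.
  by rewrite (unsplitK (inl j)); congr (inl (_, _)); exact: val_inj.
by rewrite (unsplitK (inr i)); congr (inr (_, _)); exact: val_inj.
Qed.

Lemma on_boundary_edge p : on_boundary (boundary_edge p).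
Proof. by rewrite /boundary_edge; case: (split p) => ? /=. Qed.

Lemma edge_label_boundary p : edge_label (boundary_edge p) = p.
Proof.
by rewrite -[RHS]splitK /boundary_edge; case: (split p).
Qed.

Lemma edge_pos_boundary e : on_boundary e -> edge_pos e = edge_label e.
Proof. by case: e => [[x j]|[i y]] /eqP /= ->; rewrite ?add0n // addnC. Qed.

(** Induction along walks, valid for all [E] at once: from the right or bottom edge of [c] a walk
    moves to its left or top edge. *)
Lemma edge_ind (P : edge n -> Prop) :
    (forall e, on_boundary e -> P e) ->
    (forall c, P (left_edge c) -> P (top_edge c) ->
       P (right_edge c) /\ P (bottom_edge c)) ->
  forall e, P e.
Proof.
move=> P0 Pc e; have [k] := ubnP (edge_diag e); elim: k e => // k IHk e.
have [/P0//|[[i j] ->]|[[i j] ->]] := edgeP e => /= h;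
  case: (Pc (i, j)) => //; apply: IHk => /=; rewrite /bump /= in h *;
  have := ltn_ord j; lia.
Qed.

Lemma iter_walk_diag E k e (f := iter k (walk_step E) e) :
  edge_diag e <= edge_diag f + k /\
  (on_boundary f \/ edge_diag f + k = edge_diag e).
Proof.
elim: k @f => [|k [IHk1 IHk2]] /=; first by rewrite addn0; split=> //; right.
move: IHk1 IHk2; set f := iter _ _ _ => IHk1 IHk2.
have [bf|[[i j] ef]|[[i j] ef]] := edgeP f.
- by rewrite walk_boundary //; split; [lia|left].
- suff : edge_diag (walk_step E f) + 1 = edge_diag f.
    by case: IHk2; [rewrite ef /= /bump|split; [|right]]; lia.
  rewrite ef walk_right; case: ifP => _ /=; rewrite /bump /=; have := ltn_ord j; lia.
- suff : edge_diag (walk_step E f) + 1 = edge_diag f.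
    case: IHk2; [rewrite ef /=|split; [|right]]; have := ltn_ord j; lia.
  rewrite ef walk_bottom; case: ifP => _ /=; rewrite /bump /=; have := ltn_ord j; lia.
Qed.

Lemma iter_walk_boundary E e : on_boundary (iter (n + n) (walk_step E) e).
Proof.
case: (iter_walk_diag E (n + n) e) => _ [//|].
set f := iter _ _ _ => h; have : 0 < edge_diag f.
  by case: f h => [[x j]|[i y]] //= _; have := ltn_ord j; lia.
suff : edge_diag e <= n + n by lia.
case: (e) => [[x j]|[i y]] /=.
  by have := ltn_ord j; have := ltn_ord x; lia.
by have := ltn_ord i; have := ltn_ord y; lia.
Qed.

Lemma exit_walk E e : exit E (walk_step E e) = exit E e.
Proof. by rewrite /exit -iterSr iterS walk_boundary ?iter_walk_boundary. Qed.

Lemma exit_iter_walk E k e : exit E (iter k (walk_step E) e) = exit E e.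
Proof. by elim: k => //= k <-; exact: exit_walk. Qed.

Lemma exit_on_boundary E e : on_boundary e -> exit E e = edge_label e.
Proof.
move=> be; rewrite /exit; congr edge_label.
by elim: (n + n) => //= k ->; exact: walk_boundary.
Qed.

Lemma exit_boundary E p : exit E (boundary_edge p) = p.
Proof. by rewrite exit_on_boundary ?on_boundary_edge ?edge_label_boundary. Qed.

Lemma exit_right E c :
  exit E (right_edge c) = exit E (if c \in E then top_edge c else left_edge c).
Proof. by rewrite -exit_walk walk_right. Qed.

Lemma exit_bottom E c :
  exit E (bottom_edge c) = exit E (if c \in E then left_edge c else top_edge c).
Proof. by rewrite -exit_walk walk_bottom. Qed.

(* Exits of the walks that enter the grid from the right in row [j] ([inl j])
   and from below in column [i] ([inr i]). *)
Definition source_edge (u : 'I_n + 'I_n) : edge n :=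
  match u with inl j => inl (ord_max, j) | inr i => inr (i, ord0) end.

Definition source_exit E u := exit E (source_edge u).

Lemma exit_row E j (x : 'I_n.+1) : (forall i : 'I_n, x <= i -> (i, j) \notin E) ->
  exit E (inl (x, j)) = source_exit E (inl j).
Proof.
have [k] := ubnP (n - x); elim: k x => // k IHk x xk H.
have [->//|xn] := eqVneq x ord_max.
have {}xn : x < n by rewrite ltn_neqAle -ltnS ltn_ord andbT; exact: xn.
have -> : inl (x, j) = left_edge (Ordinal xn, j) :> edge n.
  by congr (inl (_, _)); exact: val_inj.
have <- : exit E (right_edge (Ordinal xn, j)) = exit E (left_edge (Ordinal xn, j)).
  by rewrite exit_right (negPf (H _ _)).
apply: IHk => [|i]; rewrite lift0 /=; first by lia.
by move=> xi; apply: H; apply: ltnW.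
Qed.

Lemma exit_col E i (y : 'I_n.+1) : (forall j : 'I_n, j < y -> (i, j) \notin E) ->
  exit E (inr (i, y)) = source_exit E (inr i).
Proof.
case: y => y; elim: y => [|y IHy] yn H.
  by congr (exit E (inr (_, _))); exact: val_inj.
have -> : inr (i, Ordinal yn) = top_edge (i, Ordinal (yn : y < n)) :> edge n.
  by congr (inr (_, _)); exact: val_inj.
have <- : exit E (bottom_edge (i, Ordinal (yn : y < n))) =
          exit E (top_edge (i, Ordinal (yn : y < n))).
  by rewrite exit_bottom (negPf (H _ _)) /=.
rewrite -(IHy (leqW yn)); last by move=> j jy; apply: H; exact: leqW.
by congr (exit E (inr (_, _))); exact: val_inj.
Qed.

(** The edges by which a walk enters [c] have an [edge_diag] one larger than [left_edge c], and
    walks never increase it, so this walk does not meet [c]. *)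
Lemma exit_after E c e : edge_diag e <= edge_diag (left_edge c) ->
  exit (c |: E) e = exit E e.
Proof.
elim/edge_ind: e => [e be|d IHl IHt]; first by rewrite !exit_on_boundary.
have dc : edge_diag (right_edge d) <= edge_diag (left_edge c) -> d == c = false.
  by move=> h; apply/eqP => e; move: h; rewrite e /= /bump; lia.
have drb : edge_diag (bottom_edge d) = edge_diag (right_edge d).
  by rewrite /= /bump.
have dl : edge_diag (left_edge d) <= edge_diag (right_edge d) by rewrite /= /bump; lia.
have dt : edge_diag (top_edge d) <= edge_diag (right_edge d).
  by rewrite /= /bump /=; have := ltn_ord d.2; lia.
split=> h.
  rewrite !exit_right in_setU1 dc //=; case: ifP => _; [apply: IHt|apply: IHl]; lia.
rewrite !exit_bottom in_setU1 dc -?drb //=; case: ifP => _; [apply: IHl|apply: IHt]; lia.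
Qed.

(** A walk avoiding [c] keeps its exit; one that enters [c], which is not an elbow of [E], leaves it
    by the left or top edge and so exits at [p] or [q]. *)
Lemma exit_smooth_cases E c e (p := exit E (left_edge c)) (q := exit E (top_edge c)) :
  c \notin E ->
  [\/ exit (c |: E) e = exit E e, exit E e = p | exit E e = q].
Proof.
move=> cE; elim/edge_ind: e => [e be|d IHl IHt].
  by constructor 1; rewrite !exit_on_boundary.
rewrite !exit_right !exit_bottom in_setU1.
have [-> /=|_ /=] := eqVneq d c.
  by rewrite (negPf cE); split; [constructor 2|constructor 3].
by case: ifP.
Qed.

Definition off_below c E := forall d, cell_ge c d -> d \notin E.

(** Smoothing [c] exchanges the continuations of its row walk and its column walk, which reach [c]
    straight from their sources. No third walk passes through [c]: it would share its exit with one
    of these two, against injectivity. *)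
Lemma source_exit_smooth E c : injective (source_exit E) -> off_below c E ->
  source_exit (c |: E) =1 source_exit E \o tperm (inl c.2) (inr c.1).
Proof.
move=> injX cE; have cNE := cE _ (cell_ge_refl c).
have row F : F = E \/ F = c |: E -> exit F (right_edge c) = source_exit F (inl c.2).
  move=> HF; apply: exit_row => i; rewrite lift0 => ci.
  suff : (i, c.2) \notin c |: E by case: HF => ->; rewrite // in_setU1 negb_or => /andP[].
  rewrite in_setU1 negb_or cE ?andbT; last by rewrite /cell_ge /=; lia.
  by apply/eqP => e; move: ci; rewrite -e ltnn.
have col F : F = E \/ F = c |: E -> exit F (bottom_edge c) = source_exit F (inr c.1).
  move=> HF; apply: exit_col => j /= cj.
  suff : (c.1, j) \notin c |: E by case: HF => ->; rewrite // in_setU1 negb_or => /andP[].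
  rewrite in_setU1 negb_or cE ?andbT; last by rewrite /cell_ge /=; lia.
  by apply/eqP => e; move: cj; rewrite -e ltnn.
have rowE : source_exit E (inl c.2) = exit E (left_edge c).
  by rewrite -row ?exit_right ?(negPf cNE) //; left.
have colE : source_exit E (inr c.1) = exit E (top_edge c).
  by rewrite -col ?exit_bottom ?(negPf cNE) //; left.
have tl : edge_diag (top_edge c) <= edge_diag (left_edge c).
  by rewrite /= /bump /=; have := ltn_ord c.2; lia.
move=> u /=; case: tpermP => [->|->|/eqP u1 /eqP u2].
- rewrite -row; last by right.
  by rewrite exit_right setU11 colE exit_after.
- rewrite -col; last by right.
  by rewrite exit_bottom setU11 rowE exit_after.
- have [//|e|e] := exit_smooth_cases (source_edge u) cNE.
    by case/eqP: u1; apply: injX; rewrite rowE.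
  by case/eqP: u2; apply: injX; rewrite colE.
Qed.

Lemma source_exit_smooth_inj E c : injective (source_exit E) -> off_below c E ->
  injective (source_exit (c |: E)).
Proof.
move=> injX cE u v; rewrite !(source_exit_smooth injX cE) => /injX.
exact: perm_inj.
Qed.

Lemma off_below_max s E c : smoothing_closed s E -> max_remaining s E c ->
  off_below c E.
Proof.
move=> [_ up] /max_remainingP[cs cE _] d cd; apply: contra cE => dE.
exact: up dE cs cd.
Qed.

(** Elbows are crossings, and row [s i] has no crossing to the right of its mark; the walk from the
    right side runs straight to the mark and continues as the strand drawn from it. *)
Lemma exit_mark_left s E i : E \subset crossings s ->
  exit E (left_edge (i, s i)) = source_exit E (inl (s i)).
Proof.
move=> /subsetP sub; apply: exit_row => k /= ik; apply/negP => /sub.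
by rewrite inE /= permK; lia.
Qed.

Lemma exit_mark_top s E i : E \subset crossings s ->
  exit E (top_edge (i, s i)) = source_exit E (inr i).
Proof.
move=> /subsetP sub; apply: exit_col => k; rewrite lift0 /= => ik.
by apply/negP => /sub; rewrite inE /=; lia.
Qed.

(** The edges on which the drawing has a line: those between a mark and the left or top boundary.
    Elbows sit on crossings, so [E] does not matter. *)
Definition carries s e : bool :=
  match e with
  | inl (x, j) => x <= (s^-1)%g j
  | inr (i, y) => s i < y
  end.

Lemma carries_crossing s c : c \in crossings s ->
  carries s (left_edge c) && carries s (top_edge c).
Proof. by rewrite inE /= /bump /= => /andP[]; lia. Qed.

Lemma carries_walk s E e : E \subset crossings s -> carries s e ->
  carries s (walk_step E e).
Proof.
move=> /subsetP sub; have [be|[c ->]|[c ->]] := edgeP e; first by rewrite walk_boundary.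
  rewrite walk_right; case: ifP => [/sub/carries_crossing/andP[]//|_] /=.
  by rewrite /bump; exact: ltnW.
rewrite walk_bottom; case: ifP => [/sub/carries_crossing/andP[]//|_] /=.
by rewrite /bump; exact: leqW.
Qed.

Lemma strand_rel_walk s E e : E \subset crossings s -> carries s e ->
  connect (strand_rel s E) e (walk_step E e).
Proof.
move=> /subsetP sub; have [be|[c ->]|[c ->]] := edgeP e.
- by rewrite walk_boundary.
- rewrite walk_right /= /bump /= => h; apply: connect1; apply/existsP; exists c.
  by case: ifP => cE; rewrite /cell_arc !eqxx cE h ?orbT.
- rewrite walk_bottom /= => h; apply: connect1; apply/existsP; exists c.
  by case: ifP => cE; rewrite /cell_arc !eqxx cE h ?orbT.
Qed.

Lemma connect_exit s E e : E \subset crossings s -> carries s e ->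
  connect (strand_rel s E) e (boundary_edge (exit E e)).
Proof.
move=> sub ce; rewrite /exit -boundary_edgeP ?iter_walk_boundary //.
suff [] : carries s (iter (n + n) (walk_step E) e) /\
          connect (strand_rel s E) e (iter (n + n) (walk_step E) e) by [].
elim: (n + n) => //= k [ck conk]; split; first exact: carries_walk.
by apply: connect_trans conk _; exact: strand_rel_walk.
Qed.

Lemma source_exit_bij E : injective (source_exit E) -> bijective (source_exit E).
Proof. by move=> injX; apply: inj_card_bij => //; rewrite card_sum !card_ord. Qed.

Lemma grid_matchingE s E : E \subset crossings s -> injective (source_exit E) ->
  grid_matching s E =
  [set [set source_exit E (inl (s i)); source_exit E (inr i)] | i : 'I_n].
Proof.
move=> sub injX; have [X' XK X'K] := source_exit_bij injX.
pose strand u := match u with inl j => (s^-1)%g j | inr i => i end.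
have strandE u : source_exit E u = source_exit E (inl (s (strand u))) \/
                 source_exit E u = source_exit E (inr (strand u)).
  by case: u => [j|i]; [left; rewrite /= permKV|right].
(* The column of the mark, read off the exit, is constant along each piece of a strand; hence
   connected boundary edges are ends belonging to the same mark. *)
have inv e f : strand_rel s E e f -> strand (X' (exit E e)) = strand (X' (exit E f)).
  case/existsP => c; wlog: e f / cell_arc s E c e f => [H /orP[]h|].
    - by apply: H; rewrite ?h.
    - by symmetry; apply: H; rewrite ?h.
  move=> + _; rewrite /cell_arc => /or4P[]; last case/orP.
  - case/and3P=> /eqP c2 /eqP-> /eqP->.
    have -> : c = (c.1, s c.1) by rewrite -c2; case: (c).
    by rewrite exit_mark_left // exit_mark_top // !XK /= permK.
  - by case/and3P=> cE /eqP-> /eqP->; rewrite exit_bottom cE.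
  - by case/and3P=> cE /eqP-> /eqP->; rewrite exit_right cE.
  - by case/and4P=> cE _ /eqP-> /eqP->; rewrite exit_right (negPf cE).
  - by case/and4P=> cE _ /eqP-> /eqP->; rewrite exit_bottom (negPf cE).
have invc e f : connect (strand_rel s E) e f ->
    strand (X' (exit E e)) = strand (X' (exit E f)).
  case/connectP => p pth ->; elim: p e pth => //= f' p IHp e /andP[/inv-> pth].
  exact: IHp.
have symr : connect_sym (strand_rel s E).
  by apply: sym_connect_sym => e f; apply: eq_existsb => c; rewrite orbC.
apply/setP => B; rewrite inE; apply/existsP/imsetP => [[p /existsP[q]]|[i _ ->]].
  case/and3P => pq /invc; rewrite !exit_boundary => epq /eqP->.
  exists (strand (X' p)) => //.
  have := strandE (X' p); have := strandE (X' q); rewrite !X'K -epq.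
  move: (strand (X' p)) => i; case=> hq [] hp; rewrite hq hp // in pq *.
  - by rewrite eqxx in pq.
  - by rewrite setUC.
  - by rewrite eqxx in pq.
exists (source_exit E (inl (s i))); apply/existsP; exists (source_exit E (inr i)).
apply/and3P; split=> //; first by apply/eqP => /injX.
have sm : strand_rel s E (left_edge (i, s i)) (top_edge (i, s i)).
  by apply/existsP; exists (i, s i); rewrite /cell_arc !eqxx.
rewrite -(exit_mark_left _ sub) -(exit_mark_top _ sub).
apply: (@connect_trans _ _ (left_edge (i, s i))).
  by rewrite symr; apply: connect_exit; rewrite //= permK.
apply: connect_trans (connect1 sm) _.
by apply: connect_exit; rewrite //= /bump /=.
Qed.

End Walks.

(** * Planarity of fully smoothed configurations *)

Section Planarity.

Variables (n : nat) (s : {perm 'I_n}).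
Let E := crossings s.
Implicit Types (c d : cell n) (e f : edge n).

(** Two walks are compared on a common diagonal, or when one has stopped at the boundary and the
    other has gone on. The two edges then lie on one lattice path, a staircase completed by boundary
    edges, and [edge_pos] is the order along it. *)
Definition synced e f :=
  [|| edge_diag e == edge_diag f,
      on_boundary e && (edge_diag f <= edge_diag e)
    | on_boundary f && (edge_diag e <= edge_diag f)].

Lemma synced_sym e f : synced e f = synced f e.
Proof. by rewrite /synced eq_sym; congr (_ || _); rewrite orbC. Qed.

Ltac walk_arith i j k l :=
  repeat case: ifP => _; rewrite /= /bump /=;
  have := ltn_ord i; have := ltn_ord j; have := ltn_ord k; have := ltn_ord l; lia.

Lemma walk_order e f : carries s e -> carries s f -> synced e f ->
  edge_pos e < edge_pos f ->
  synced (walk_step E e) (walk_step E f) /\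
  edge_pos (walk_step E e) < edge_pos (walk_step E f).
Proof.
rewrite /synced.
have [be|[[i j] ->]|[[i j] ->]] := edgeP e;
  have [bf|[[k l] ->]|[[k l] ->]] := edgeP f; rewrite ?walk_right ?walk_bottom.
- by move=> _ _ sy lt; rewrite !walk_boundary.
- by rewrite walk_boundary //; case: e be => [[x y]|[x y]]; walk_arith x y k l.
- by rewrite walk_boundary //; case: e be => [[x y]|[x y]]; walk_arith x y k l.
- by rewrite (walk_boundary _ bf); case: f bf => [[x y]|[x y]]; walk_arith x y i j.
- by walk_arith i j k l.
- by walk_arith i j k l.
- by rewrite (walk_boundary _ bf); case: f bf => [[x y]|[x y]]; walk_arith x y i j.
(* Only here can both walks enter the same cell, [e] from below and [f] from the right. Carrying
   both lines makes it a crossing, hence an elbow, which turns [e] left and [f] up without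
   exchanging them. *)
- have [[<- <-]|ne] := eqVneq (i, j) (k, l).
    move=> ce cf; have -> : (i, j) \in E.
      by move: ce cf; rewrite inE /= /bump /= => -> ->.
    rewrite /= /bump /=; have := ltn_ord j; lia.
  have {ne} : (i != k :> nat) || (j != l :> nat).
    by move: ne; rewrite xpair_eqE negb_and.
  by walk_arith i j k l.
- by walk_arith i j k l.
Qed.


Lemma carries_iter k e : carries s e -> carries s (iter k (walk_step E) e).
Proof. by move=> ce; elim: k => //= k; exact: carries_walk. Qed.

Lemma exit_lt e f : carries s e -> carries s f -> synced e f ->
  edge_pos e < edge_pos f -> exit E e < exit E f.
Proof.
move=> ce cf sy lt; rewrite /exit -!edge_pos_boundary ?iter_walk_boundary //.
suff [] : synced (iter (n + n) (walk_step E) e) (iter (n + n) (walk_step E) f) /\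
  edge_pos (iter (n + n) (walk_step E) e) < edge_pos (iter (n + n) (walk_step E) f) by [].
by elim: (n + n) => //= k [sk ltk]; apply: walk_order => //; exact: carries_iter.
Qed.

Lemma synced_pos_inj e f : synced e f -> edge_pos e = edge_pos f -> e = f.
Proof.
case: e f => [[x j]|[i y]] [[x' j']|[i' y']]; rewrite /synced /=.
- have := ltn_ord j; have := ltn_ord j' => h1 h2 h3 h4.
  by congr (inl (_, _)); apply: val_inj => /=; lia.
- by have := ltn_ord j; have := ltn_ord i'; have := ltn_ord y'; lia.
- by have := ltn_ord i; have := ltn_ord j'; have := ltn_ord y; lia.
- have := ltn_ord i; have := ltn_ord i'; have := ltn_ord y => h1 h2 h3.
  have := ltn_ord y' => h4 h5 h6.
  by congr (inr (_, _)); apply: val_inj => /=; lia.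
Qed.

Lemma pos_lt_exit e f : carries s e -> carries s f -> synced e f ->
  exit E e < exit E f -> edge_pos e < edge_pos f.
Proof.
move=> ce cf sy lt; case: (ltngtP (edge_pos e) (edge_pos f)) => // h.
  by have := exit_lt cf ce _ h; rewrite synced_sym => /(_ sy); lia.
by move: lt; rewrite (synced_pos_inj sy h) ltnn.
Qed.

Lemma synced_iter e f : edge_diag f <= edge_diag e ->
  synced (iter (edge_diag e - edge_diag f) (walk_step E) e) f.
Proof.
move=> h; have [h1 [h2|h2]] := iter_walk_diag E (edge_diag e - edge_diag f) e;
  rewrite /synced; lia.
Qed.

Let mark_left i : edge n := left_edge (i, s i).
Let mark_top i : edge n := top_edge (i, s i).

Lemma mark_diag i : edge_diag (mark_top i) = edge_diag (mark_left i).
Proof. by rewrite /= /bump /=; have := ltn_ord (s i); lia. Qed.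

Lemma mark_pos i : edge_pos (mark_top i) = (edge_pos (mark_left i)).+1.
Proof. by rewrite /= /bump /=; lia. Qed.

Lemma carries_mark_left i : carries s (mark_left i).
Proof. by rewrite /= permK. Qed.

Lemma carries_mark_top i : carries s (mark_top i).
Proof. by rewrite /= /bump. Qed.

Lemma mark_exit_lt i : exit E (mark_left i) < exit E (mark_top i).
Proof.
apply: exit_lt; rewrite ?carries_mark_left ?carries_mark_top ?mark_pos //.
by rewrite /synced mark_diag eqxx.
Qed.

(* The strand whose mark comes last on a diagonal starts with two adjacent
   positions, and no leg of the other strand fits between them. *)
Lemma mark_exit_noncrossing i k :
  exit E (mark_left i) < exit E (mark_left k) ->
  exit E (mark_left k) < exit E (mark_top i) ->
  exit E (mark_top i) < exit E (mark_top k) -> False.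
Proof.
move=> h1 h2 h3; have := leq_total (edge_diag (mark_left k)) (edge_diag (mark_left i)).
case/orP => le.
  have {}le : edge_diag (mark_left k) <= edge_diag (mark_top i) by rewrite mark_diag.
  have sl := synced_iter le; have st := synced_iter (f := mark_top k) (e := mark_top i).
  rewrite mark_diag in st; move/(_ le) in st.
  move: sl st; set e := iter _ _ _ => sl st.
  have ce : carries s e by apply: carries_iter; exact: carries_mark_top.
  have ee : exit E e = exit E (mark_top i) by exact: exit_iter_walk.
  rewrite -ee in h2 h3; rewrite synced_sym in sl.
  have := pos_lt_exit (carries_mark_left _) ce sl h2.
  by have := pos_lt_exit ce (carries_mark_top _) st h3; rewrite mark_pos; lia.
have sl := synced_iter le; have st := synced_iter (f := mark_top i) (e := mark_left k).
rewrite mark_diag in st; move/(_ le) in st.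
move: sl st; set e := iter _ _ _ => sl st.
have ce : carries s e by apply: carries_iter; exact: carries_mark_left.
have ee : exit E e = exit E (mark_left k) by exact: exit_iter_walk.
rewrite -ee in h1 h2; rewrite synced_sym in sl.
have := pos_lt_exit (carries_mark_left _) ce sl h1.
by have := pos_lt_exit ce (carries_mark_top _) st h2; rewrite mark_pos; lia.
Qed.

End Planarity.

(** * Matchings and independence of the web basis *)

Lemma increasing_enum N n (A : {set 'I_N}) : #|A| = n ->
  exists f : 'I_n -> 'I_N, (forall i k : 'I_n, i < k -> f i < f k) /\
    (forall p, p \in A <-> exists i, p = f i).
Proof.
move=> cA; case: n cA => [/cards0_eq->|n cA].
  have f : 'I_0 -> 'I_N by case.
  by exists f; split=> [[]//|p]; rewrite inE; split=> // -[[]].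
have szA : size (enum A) = n.+1 by rewrite -cardE.
have [x0 _] : exists x, x \in A by apply/card_gt0P; rewrite cA.
have sortA : sorted (fun p q : 'I_N => p < q) (enum A).
  rewrite /enum_mem; apply: sorted_filter; first by move=> ? ? ?; exact: ltn_trans.
  have : sorted ltn (map val (enum 'I_N)) by rewrite val_enum_ord iota_ltn_sorted.
  by rewrite sorted_map enumT.
exists (fun i => nth x0 (enum A) i); split=> [i k ik|p].
  apply: (sorted_ltn_nth (leT := fun p q : 'I_N => p < q)) => //.
  - by move=> ? ? ?; exact: ltn_trans.
  - by rewrite inE szA.
  - by rewrite inE szA.
rewrite -mem_enum; split=> [pA|[i ->]]; last by rewrite mem_nth ?szA.
have lt : index p (enum A) < n.+1 by rewrite -szA index_mem.
by exists (Ordinal lt); rewrite /= nth_index.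
Qed.

Section Arcs.

Variable n : nat.
Implicit Types (M : matching n) (b : 'I_n + 'I_n -> 'I_(n + n)).

(** One indexing serves for openers and closers, for the rows of a tableau, and for the row and
    column ends of strands. *)
Definition arcs b : matching n := [set [set b (inl i); b (inr i)] | i : 'I_n].

Lemma set2_inj (p q r : 'I_(n + n)) : p != q -> [set p; q] = [set p; r] -> q = r.
Proof.
move=> pq /setP /(_ q); rewrite !inE eqxx orbT eq_sym (negPf pq) /=.
by move/esym/eqP.
Qed.

Lemma matching_neq M p q : is_matching M -> [set p; q] \in M -> p != q.
Proof.
case/andP => _ /forall_inP H /H; rewrite cards2; by case: (p != q).
Qed.

Lemma matching_inj M p q r : is_matching M ->
  [set p; q] \in M -> [set p; r] \in M -> q = r.
Proof.
move=> mM pq pr; apply: (@set2_inj p); first exact: matching_neq mM pq.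
case/andP: mM => /and3P[_ /trivIsetP tr _] _.
apply/eqP; apply: contraT => /(tr _ _ pq pr).
by move/disjoint_setI0/setP/(_ p); rewrite !inE eqxx.
Qed.

Lemma matching_mate M p : is_matching M -> exists q, [set p; q] \in M.
Proof.
case/andP => /and3P[/eqP cov _ _] /forall_inP H.
have : p \in cover M by rewrite cov.
case/bigcupP => B BM pB; have := H _ BM => /cards2P[x [y [xy eB]]].
move: pB BM; rewrite eB in_set2 => /orP[]/eqP-> BM; first by exists y.
by exists x; rewrite setUC.
Qed.

Lemma matching_blockP M B : is_matching M -> B \in M ->
  exists p q : 'I_(n + n), p < q /\ B = [set p; q].
Proof.
case/andP => _ /forall_inP H /H /cards2P[x [y [xy ->]]].
have [lt|lt|e] := ltngtP x y; first by exists x, y.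
  by exists y, x; rewrite setUC.
by case/eqP: xy; exact: val_inj.
Qed.

Lemma openerP M (p : 'I_(n + n)) :
  reflect (exists2 q : 'I_(n + n), p < q & [set p; q] \in M) (opener M p).
Proof.
by apply: (iffP existsP) => [[q /andP[]]|[q lt pq]]; exists q => //; rewrite lt.
Qed.

Lemma arcsP b p q : injective b -> [set p; q] \in arcs b -> p != q ->
  exists i, (p = b (inl i) /\ q = b (inr i)) \/ (p = b (inr i) /\ q = b (inl i)).
Proof.
move=> inj_b /imsetP[i _ e] pq; exists i.
have : p \in [set b (inl i); b (inr i)] by rewrite -e !inE eqxx.
rewrite !inE => /orP[]/eqP ep; [left|right]; split=> //.
  by apply: (set2_inj pq); rewrite e -ep.
by apply: (set2_inj pq); rewrite e -ep setUC.
Qed.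

Lemma arcs_matching b : injective b -> is_matching (arcs b).
Proof.
move=> inj_b; have [b' _ b'K] : bijective b.
  by apply: inj_card_bij => //; rewrite card_sum !card_ord.
apply/andP; split; last first.
  apply/forall_inP => _ /imsetP[i _ ->]; rewrite cards2.
  by rewrite (inj_eq inj_b).
apply/and3P; split.
- apply/eqP/setP => p; rewrite inE; apply/bigcupP.
  case e : (b' p) => [i|i].
    exists [set b (inl i); b (inr i)]; first exact: imset_f.
    by rewrite -[p]b'K e !inE eqxx.
  exists [set b (inl i); b (inr i)]; first exact: imset_f.
  by rewrite -[p]b'K e !inE eqxx orbT.
- apply/trivIsetP => _ _ /imsetP[i _ ->] /imsetP[k _ ->] ne.
  have {ne} ik : i != k by apply: contraNneq ne => ->.
  rewrite -setI_eq0; apply/eqP/setP => p; rewrite !inE.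
  by apply/negP => /andP[/orP[]/eqP-> /orP[]/eqP/inj_b e]; case: e ik => // ->; rewrite eqxx.
- by apply/imsetP => -[i _ /setP/(_ (b (inl i)))]; rewrite !inE eqxx.
Qed.

Lemma opener_arcs b p : injective b -> (forall i, b (inl i) < b (inr i)) ->
  reflect (exists i, p = b (inl i)) (opener (arcs b) p).
Proof.
move=> inj_b lt_b; apply: (iffP (openerP _ _)) => [[q pq]|[i ->]].
  move=> /arcsP-/(_ inj_b); case=> [|i [[-> _]|[ep eq]]]; last 2 first.
  - by exists i.
  - by move: pq; rewrite ep eq; have := lt_b i; lia.
  - by apply/eqP => e; rewrite e ltnn in pq.
by exists (b (inr i)) => //; exact: imset_f.
Qed.

Lemma matching_arcs M : is_matching M -> exists b : 'I_n + 'I_n -> 'I_(n + n),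
  [/\ injective b, forall i, b (inl i) < b (inr i),
      forall i k : 'I_n, i < k -> b (inl i) < b (inl k) & M = arcs b].
Proof.
move=> mM; pose A := [set p | opener M p].
have cA : #|A| = n.
  have -> : #|A| = #|M|.
    have -> : M = [set pblock M p | p in A].
      apply/setP => B; apply/idP/imsetP => [BM|[p]].
        have [p [q [pq eB]]] := matching_blockP mM BM.
        exists p; first by rewrite inE; apply/openerP; exists q; rewrite -?eB.
        case/andP: mM => /and3P[_ tr _] _.
        by rewrite (def_pblock tr BM) // eB !inE eqxx.
      rewrite inE => /openerP[q pq pM] ->; apply: pblock_mem.
      by case/andP: mM => /and3P[/eqP-> _ _] _; rewrite inE.
    rewrite card_in_imset // => p p'; rewrite !inE => /openerP[q pq pM] /openerP[q' pq' pM'].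
    have tr : trivIset M by case/andP: mM => /and3P[].
    rewrite (def_pblock tr pM) ?(def_pblock tr pM') ?inE ?eqxx // => e.
    have : p \in [set p'; q'] by rewrite -e !inE eqxx.
    rewrite !inE => /orP[/eqP//|/eqP ep].
    have : p' \in [set p; q] by rewrite e !inE eqxx.
    by rewrite !inE => /orP[]/eqP e'; move: pq pq'; rewrite e' ep; lia.
  case/andP: mM => pM /forall_inP H.
  have := @card_uniform_partition _ 2 M _ (fun B BM => eqP (H B BM)) pM.
  by rewrite cardsT card_ord; lia.
have [f [incf fA]] := increasing_enum cA.
have fin : forall i : 'I_n, exists q : 'I_(n + n), (f i < q) && ([set f i; q] \in M).
  move=> i; have : f i \in A by apply/fA; exists i.
  by rewrite inE => /openerP[q ? ?]; exists q; apply/andP.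
pose g i := xchoose (fin i).
have ltg i : f i < g i by have /andP[] := xchooseP (fin i).
have fg i : [set f i; g i] \in M by have /andP[] := xchooseP (fin i).
have gf i : [set g i; f i] \in M by rewrite setUC.
have injf : injective f.
  move=> i k e; apply: val_inj => /=.
  by have [/incf|/incf|//] := ltngtP i k; rewrite e ltnn.
exists (fun u => match u with inl i => f i | inr i => g i end).
split=> //.
- move=> [i|i] [k|k] e; try congr (inl _); try congr (inr _).
  + exact: injf.
  + have e' : g i = f k by apply: (@matching_inj M (f i)) => //; rewrite e.
    by have := ltg i; have := ltg k; rewrite e e'; lia.
  + have e' : f i = g k by apply: (@matching_inj M (g i)) => //; rewrite e.
    by have := ltg i; have := ltg k; rewrite e e'; lia.
  + by apply: injf; apply: (@matching_inj M (g i)) => //; rewrite e.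
- apply/setP => B; apply/idP/imsetP => [BM|[i _ ->] //].
  have [p [q [pq eB]]] := matching_blockP mM BM; rewrite eB in BM *.
  have : p \in A by rewrite inE; apply/openerP; exists q.
  case/fA => i ep; exists i => //; rewrite ep in BM *.
  by rewrite (matching_inj mM BM (fg i)).
Qed.

Lemma noncrossingP M (a b c d : 'I_(n + n)) : noncrossing M -> a < b -> b < c -> c < d ->
  [set a; c] \in M -> [set b; d] \in M -> False.
Proof.
case/andP => _ /negP H ab bc cd ac bd; apply: H.
apply/existsP; exists a; apply/existsP; exists b.
by apply/existsP; exists c; apply/existsP; exists d; rewrite ab bc cd ac bd.
Qed.

(** Induction on the length of an arc [{p, q}] of one matching. In the other, [q] is a closer with
    some mate [p']. If [p < p'], the shorter arc [{p', q}] belongs to both, which is absurd; if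
    [p' < p], the arc opened at [p] is either shorter than [{p, q}], again absurd, or crosses
    [{p', q}]. *)
Lemma noncrossing_opener_inj M M' : noncrossing M -> noncrossing M' ->
  opener M =1 opener M' -> M = M'.
Proof.
move=> ncM ncM' eop.
suff H (d : nat) (p q : 'I_(n + n)) : p < q -> q - p < d ->
    ([set p; q] \in M) = ([set p; q] \in M').
  have mM := andP ncM; have mM' := andP ncM'.
  apply/setP => B; apply/idP/idP => BM.
    have [p [q [pq eB]]] := matching_blockP mM.1 BM.
    by rewrite eB -(H (q - p).+1) // -eB.
  have [p [q [pq eB]]] := matching_blockP mM'.1 BM.
  by rewrite eB (H (q - p).+1) // -eB.
elim: d p q => // d IHd p q pq qpd.
suff half (M1 M2 : matching n) :
    noncrossing M1 -> noncrossing M2 -> opener M1 =1 opener M2 ->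
    (forall p q : 'I_(n + n), p < q -> q - p < d ->
       [set p; q] \in M2 -> [set p; q] \in M1) ->
    [set p; q] \in M1 -> [set p; q] \in M2.
  apply/idP/idP; apply: half => // p' q' pq' h; first by rewrite IHd.
  by rewrite -IHd.
move=> {IHd M M' ncM ncM' eop} nc1 nc2 eop IHd pM1.
have [m1 m2] : is_matching M1 /\ is_matching M2 by case/andP: nc1; case/andP: nc2.
have [p' qM2] := matching_mate q m2.
have p'q : p' < q.
  have [//|lt|e] := ltngtP p' q; last first.
    by have := matching_neq m2 qM2; rewrite -(val_inj e) eqxx.
  have : opener M1 q by rewrite eop; apply/openerP; exists p'.
  case/openerP => r qr rM1; have := matching_inj m1 rM1 (_ : [set q; p] \in M1).
  by rewrite setUC => /(_ pM1) e; rewrite e in qr; lia.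
have [lt|lt|e] := ltngtP p' p; last by rewrite -(val_inj e) setUC.
- have : opener M2 p by rewrite -eop; apply/openerP; exists q.
  case/openerP => r pr rM2.
  have [lt'|lt'|e] := ltngtP r q.
  + have := IHd p r pr _ rM2 => /(_ ltac:(lia)) rM1.
    by rewrite -(matching_inj m1 rM1 pM1) in lt'; rewrite ltnn in lt'.
  + rewrite setUC in qM2; by have := noncrossingP nc2 lt pq lt' qM2 rM2.
  + rewrite (val_inj e) setUC in rM2.
    by rewrite (matching_inj m2 qM2 rM2) ltnn in lt.
- rewrite setUC in qM2; have := IHd p' q p'q _ qM2 => /(_ ltac:(lia)).
  rewrite setUC => qM1; rewrite setUC in pM1.
  by rewrite (matching_inj m1 qM1 pM1) ltnn in lt.
Qed.

End Arcs.

(** * Independence of the noncrossing products *)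

Section WebBasis.

Variables (C : fieldType) (n : nat).
Implicit Types (M : matching n) (b : 'I_n + 'I_n -> 'I_(n + n)).
Implicit Type S : {set 'I_(n + n)}.
Local Open Scope ring_scope.

Lemma Delta_arcs b : injective b -> (forall i, (b (inl i) < b (inr i))%N) ->
  Delta C (arcs b) = \prod_i Delta_arc C (b (inl i)) (b (inr i)).
Proof.
move=> inj_b lt_b; rewrite /Delta.
pose h i := (b (inl i), b (inr i)).
rewrite (eq_bigl (mem (h @: setT))) => [|[p q]] /=.
  by rewrite big_imset /= => [|i k _ _ [/inj_b[]]] //; apply: eq_bigl => i; rewrite inE.
apply/andP/imsetP => [[pq]|[i _ [-> ->]]]; last by split; [exact: lt_b|exact: imset_f].
case/(arcsP inj_b) => [|i [[-> ->]|[ep eq]]]; last 2 first.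
- by exists i.
- by move: pq; rewrite ep eq; have := lt_b i; lia.
- by apply/eqP => e; rewrite e ltnn in pq.
Qed.

(** Column [i] of the matrix is the first unit vector for [i] in [S] and the second otherwise, so a
    minor is nonzero exactly when one of its two columns is indexed in [S]. *)
Definition indicator_point S (k : 'I_(2 * (n + n))) : C :=
  mxvec (\matrix_(r < 2, i < n + n) ((i \in S) == (r == ord0))%:R) ord0 k.

Lemma meval_zmat S r i :
  (zmat C n r i).@[indicator_point S] = ((i \in S) == (r == ord0))%:R.
Proof. by rewrite mxE mevalXU /indicator_point mxvecE mxE. Qed.

Lemma meval_Delta_arc S i j : (Delta_arc C i j).@[indicator_point S] =
  (i \in S)%:R * (j \notin S)%:R - (j \in S)%:R * (i \notin S)%:R.
Proof.
rewrite /Delta_arc mevalB !mevalM !meval_zmat /=.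
by case: (i \in S); case: (j \in S).
Qed.

Lemma meval_Delta_neq0 S M : (Delta C M).@[indicator_point S] != 0 ->
  forall i j : 'I_(n + n), (i < j)%N -> [set i; j] \in M -> (i \in S) (+) (j \in S).
Proof.
rewrite /Delta rmorph_prod => /prodf_neq0 H i j ij ijM.
have := H (i, j); rewrite /= ij ijM => /(_ isT); rewrite meval_Delta_arc.
by case: (i \in S); case: (j \in S); rewrite //= ?mulr0 ?mul0r ?subrr eqxx.
Qed.

Definition openers M := [set p | opener M p].

Lemma meval_Delta_openers M : is_matching M ->
  (Delta C M).@[indicator_point (openers M)] != 0.
Proof.
move=> mM; rewrite /Delta rmorph_prod; apply/prodf_neq0 => -[i j] /= /andP[ij ijM].
rewrite meval_Delta_arc !inE.
have -> : opener M i by apply/openerP; exists j.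
have -> : opener M j = false.
  case: openerP => // -[k jk jM]; rewrite setUC in ijM.
  by have := matching_inj mM ijM jM => e; rewrite -e in jk; lia.
by rewrite /= mulr0 subr0 mulr1 oner_eq0.
Qed.

Definition opener_weight M : nat := \sum_(p in openers M) p.

(** A nonzero value gives every arc of [M] exactly one end among the openers of [M']. Picking the
    smaller end of each arc minimises the sum, so [M] has at most the weight of [M'], with equality
    only if the openers agree. *)
Lemma meval_Delta_triangular M M' : noncrossing M -> noncrossing M' ->
    (Delta C M).@[indicator_point (openers M')] != 0 ->
  (opener_weight M < opener_weight M')%N \/ M = M'.
Proof.
move=> ncM ncM' /meval_Delta_neq0 one; set S := openers M' in one.
have [/andP[mM _] /andP[mM' _]] := (ncM, ncM').
have [b [inj_b lt_b _ eM]] := matching_arcs mM.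
have bij_b : bijective b by apply: inj_card_bij => //; rewrite card_sum !card_ord.
have oneb i : (b (inl i) \in S) (+) (b (inr i) \in S).
  by apply: one => //; rewrite eM; exact: imset_f.
have opb u : (b u \in openers M) = if u is inl _ then true else false.
  rewrite inE eM; apply/opener_arcs/idP => //.
    by case: u => // i [k /inj_b].
  by case: u => // i _; exists i.
have weightE (A : {set 'I_(n + n)}) : (\sum_(p in A) p =
    \sum_i ((b (inl i) \in A) * b (inl i) + (b (inr i) \in A) * b (inr i)))%N.
  rewrite big_mkcond (reindex b) /=; last exact: onW_bij.
  rewrite big_split big_sumType /=; congr addn; apply: eq_bigr => i _.
    by case: ifP; rewrite ?mul1n.
  by case: ifP; rewrite ?mul1n.
have le : (opener_weight M <= opener_weight M' ?= iff [forall i, b (inl i) \in S])%N.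
  rewrite /opener_weight !weightE.
  apply: (@leqif_sum _ _ (fun i => b (inl i) \in S)) => i _; rewrite !opb -/S.
  have := oneb i; have := lt_b i.
  case: (b (inl i) \in S); case: (b (inr i) \in S) => // lt _.
    by rewrite !mul1n mul0n addn0; apply/leqif_refl.
  rewrite !mul1n !mul0n addn0 add0n; split; [exact: ltnW|exact: ltn_eqF].
move: (le.1); rewrite leq_eqVlt le.2 => /orP[/forallP allS|]; last by left.
right; apply: noncrossing_opener_inj => // p.
have [b' bK b'K] := bij_b; rewrite -[p]b'K.
have := opb (b' p); rewrite inE => ->.
case: (b' p) => i; first by have := allS i; rewrite inE.
by have := oneb i; rewrite allS [_ \in S]inE; case: opener.
Qed.

Lemma Delta_noncrossing_free (c : matching n -> C) :
    \sum_(M | noncrossing M) c M *: Delta C M = 0 ->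
  forall M, noncrossing M -> c M = 0.
Proof.
move=> sum0 M; have [k] := ubnP (opener_weight M).
elim: k M => // k IHk M Mk ncM.
have := congr1 (meval (indicator_point (openers M))) sum0.
rewrite meval0 raddf_sum (bigD1 M) //= big1 => [|M1 /andP[ncM1 neM]]; last first.
  rewrite mevalZ; have [->|ne0] := eqVneq (Delta C M1).@[indicator_point (openers M)] 0.
    by rewrite mulr0.
  case: (meval_Delta_triangular ncM1 ncM ne0) => [lt|e]; last by rewrite e eqxx in neM.
  by rewrite IHk ?mul0r //; lia.
rewrite addr0 mevalZ => /eqP; rewrite mulf_eq0 => /orP[/eqP//|].
by case/andP: ncM => mM _; rewrite (negPf (meval_Delta_openers mM)).
Qed.

End WebBasis.

(** * Expansion over the leaves of the resolution *)

Lemma card_ord_ltn n j : j <= n -> #|[set k : 'I_n | k < j]| = j.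
Proof.
move=> jn; rewrite -sum1_card; under eq_bigl do rewrite inE.
by rewrite -(big_ord_widen n (fun=> 1)) // sum1_card card_ord.
Qed.

Lemma initial_segment n (A : {set 'I_n}) :
    (forall i k : 'I_n, i <= k -> k \in A -> i \in A) ->
  forall i : 'I_n, (i \in A) = (i < #|A|).
Proof.
move=> down i; apply/idP/idP => [iA|].
  rewrite -(card_ord_ltn (ltn_ord i)) subset_leq_card //.
  by apply/subsetP => k; rewrite inE ltnS => /down; apply.
apply: contraLR => iA; rewrite -leqNgt -[X in _ <= X](card_ord_ltn (ltnW (ltn_ord i))).
rewrite subset_leq_card //; apply/subsetP => k kA; rewrite inE ltnNge.
by apply: contra iA => ik; exact: down ik kA.
Qed.

Section Expansion.

Variables (C : fieldType) (n : nat).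
Implicit Types (s t : {perm 'I_n}) (E : {set cell n}) (c d : cell n).
Implicit Type b : 'I_n + 'I_n -> 'I_(n + n).

Definition strand_ends s E (u : 'I_n + 'I_n) : 'I_(n + n) :=
  match u with
  | inl i => source_exit E (inl (s i))
  | inr i => source_exit E (inr i)
  end.

Lemma strand_ends_inj s E : injective (source_exit E) -> injective (strand_ends s E).
Proof.
move=> injX [i|i] [k|k] /injX; last 3 first.
- by [].
- by [].
- by case=> ->.
- by case=> /perm_inj ->.
Qed.

Definition grid_inv s E := smoothing_closed s E /\ injective (source_exit E).

Lemma grid_inv_resolve s E c : grid_inv s E -> max_remaining s E c ->
  grid_inv s (c |: E) /\ grid_inv (switch s c) E.
Proof.
move=> [sc injX] cm; split; split=> //.
- exact: smoothing_closed_smooth.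
- by apply: source_exit_smooth_inj => //; exact: off_below_max sc cm.
- exact: smoothing_closed_switch.
Qed.

Lemma grid_inv_leaf s E t : grid_inv s E -> leaf s E t -> grid_inv t (crossings t).
Proof.
move=> i0; apply: leaf_ind i0 => s1 E1 i1 s2 E2 /resolveP[c cm].
by case: (grid_inv_resolve i1 cm) => i2 i3 [] [-> ->].
Qed.

Lemma matching_of_permE t : grid_inv t (crossings t) ->
  matching_of_perm t = arcs (strand_ends t (crossings t)).
Proof. by case=> -[sub _] injX; rewrite /matching_of_perm grid_matchingE. Qed.

Lemma strand_ends_lt t i : grid_inv t (crossings t) ->
  strand_ends t (crossings t) (inl i) < strand_ends t (crossings t) (inr i).
Proof.
case=> -[sub _] _ /=; rewrite -(exit_mark_left i sub) -(exit_mark_top i sub).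
exact: mark_exit_lt.
Qed.

Lemma noncrossing_matching_of_perm t : grid_inv t (crossings t) ->
  noncrossing (matching_of_perm t).
Proof.
move=> it; have [[sub _] injX] := it; have inj_b := @strand_ends_inj t _ injX.
have lt_b i := strand_ends_lt i it; rewrite matching_of_permE //.
rewrite /noncrossing arcs_matching //=.
apply/negP => /existsP[p /existsP[q /existsP[p' /existsP[q' /and5P[pq qp' p'q' pM qM]]]]].
have ends (x y : 'I_(n + n)) : x < y ->
    [set x; y] \in arcs (strand_ends t (crossings t)) ->
    exists i, x = exit (crossings t) (left_edge (i, t i)) /\
              y = exit (crossings t) (top_edge (i, t i)).
  move=> xy /(arcsP inj_b); case=> [|i [[-> ->]|[ex ey]]].
  - by apply/eqP => e; rewrite e ltnn in xy.
  - by exists i; rewrite exit_mark_left // exit_mark_top.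
  - by move: xy; rewrite ex ey; have := lt_b i; lia.
have [i [ep ep']] := ends _ _ (ltn_trans pq qp') pM.
have [k [eq eq']] := ends _ _ (ltn_trans qp' p'q') qM.
subst; exact: mark_exit_noncrossing pq qp' p'q'.
Qed.

Local Open Scope ring_scope.

(** Each factor is oriented from row end to column end, not by increasing labels, so that resolving
    produces no signs; at a leaf [strand_ends_lt] makes the two orientations agree. *)
Definition strand_prod s E : web_ring C n :=
  \prod_i Delta_arc C (strand_ends s E (inl i)) (strand_ends s E (inr i)).

(* The Pluecker relation for the two strands through [c]: smoothing exchanges
   the exits of row [c.2] and column [c.1], switching exchanges their partners. *)
Lemma strand_prod_resolve s E c : grid_inv s E -> max_remaining s E c ->
  strand_prod s E = strand_prod s (c |: E) + strand_prod (switch s c) E.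
Proof.
move=> [sc injX] cm; have offc := off_below_max sc cm.
have [+ _ _] := max_remainingP _ _ _ cm; rewrite inE => /andP[c1 c2].
have Xc := source_exit_smooth injX offc.
set k := (s^-1)%g c.2 in c2.
have sk : s k = c.2 by rewrite permKV.
have kc : k != c.1 by apply/eqP => e; rewrite e ltnn in c2.
(* Only the strands marked in column [c.1] and in row [c.2], that is in column [k], are affected. *)
have split2 (F : 'I_n -> web_ring C n) :
    \prod_i F i = F c.1 * F k * \prod_(i | (i != c.1) && (i != k)) F i.
  by rewrite (bigD1 c.1) //= (bigD1 k) //= mulrA.
rewrite /strand_prod !split2 /=.
have -> : \prod_(i | (i != c.1) && (i != k))
    Delta_arc C (source_exit (c |: E) (inl (s i))) (source_exit (c |: E) (inr i)) =
  \prod_(i | (i != c.1) && (i != k))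
    Delta_arc C (source_exit E (inl (s i))) (source_exit E (inr i)).
  apply: eq_bigr => i /andP[ic ik]; rewrite !Xc /= !tpermD //.
    by apply/eqP => -[/esym/eqP]; rewrite (negPf ic).
  by apply/eqP => -[]; rewrite -sk => /perm_inj/esym/eqP; rewrite (negPf ik).
have -> : \prod_(i | (i != c.1) && (i != k))
    Delta_arc C (source_exit E (inl (switch s c i))) (source_exit E (inr i)) =
  \prod_(i | (i != c.1) && (i != k))
    Delta_arc C (source_exit E (inl (s i))) (source_exit E (inr i)).
  apply: eq_bigr => i /andP[ic ik]; rewrite switchE (negPf ic) -sk.
  by rewrite (inj_eq perm_inj) (negPf ik).
rewrite -mulrDl; congr (_ * _).
rewrite !Xc /= !switchE eqxx (negPf kc) sk eqxx tpermL tpermR !tpermD //; last first.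
  by apply/eqP => -[e]; rewrite e ltnn in c1.
  by apply/eqP => -[e]; rewrite e eqxx in kc.
(* With [p], [q] the row and column ends of strand [c.1] and [p'], [q'] those of strand [k], this is
   [[pq][p'q'] = [pp'][qq'] + [p'q][pq']]. *)
rewrite /Delta_arc; ring.
Qed.

Lemma Delta_matching_of_perm t : grid_inv t (crossings t) ->
  Delta C (matching_of_perm t) = strand_prod t (crossings t).
Proof.
move=> it; rewrite matching_of_permE // Delta_arcs //.
  by case: it => _; exact: strand_ends_inj.
by move=> i; exact: strand_ends_lt.
Qed.

Lemma strand_prod_expansion s E : grid_inv s E ->
  strand_prod s E = \sum_(t | leaf s E t) Delta C (matching_of_perm t).
Proof.
move=> iE; rewrite (leaf_sum (inv := grid_inv) (F := strand_prod)) //.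
- by apply: eq_bigr => t lf; rewrite Delta_matching_of_perm //; exact: grid_inv_leaf iE lf.
- by move=> ? ? [].
- move=> s1 E1 c i1 cm; have [i2 i3] := grid_inv_resolve i1 cm.
  by split=> //; exact: strand_prod_resolve.
Qed.

End Expansion.

(** * Nonnesting matchings as grid configurations *)

Section NonnestingGrid.

Variables (n : nat) (b : 'I_n + 'I_n -> 'I_(n + n)).
Hypotheses (inj_b : injective b) (lt_b : forall i, b (inl i) < b (inr i)).
Hypothesis mono_l : forall i k : 'I_n, i < k -> b (inl i) < b (inl k).
Hypothesis mono_r : forall i k : 'I_n, i < k -> b (inr i) < b (inr k).

(* The cells above the Dyck path of [arcs b]. *)
Definition outer_cells : {set cell n} := [set c | b (inr c.1) < b (inl c.2)].

Lemma label_count (p : 'I_(n + n)) :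
  #|[set k : 'I_n | b (inl k) < p]| + #|[set i : 'I_n | b (inr i) < p]| = p.
Proof.
rewrite -[RHS](card_ord_ltn (ltnW (ltn_ord p))) -!sum1_card.
rewrite [RHS](reindex b) /=; last first.
  by apply: onW_bij; apply: inj_card_bij => //; rewrite card_sum !card_ord.
by rewrite [RHS]big_sumType /=; congr addn; apply: eq_bigl => i; rewrite !inE.
Qed.

Lemma mono_ltE (f : 'I_n -> 'I_(n + n)) : (forall i k : 'I_n, i < k -> f i < f k) ->
  forall i k, (f i < f k) = (i < k).
Proof.
move=> mf i k; apply/idP/idP; last exact: mf.
have [//|/mf h|/val_inj->] := ltngtP i k; rewrite ?ltnn //; lia.
Qed.

Lemma opener_pos (j : 'I_n) : #|[set i : 'I_n | b (inr i) < b (inl j)]| + j = b (inl j).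
Proof.
rewrite -[RHS]label_count addnC; congr addn.
rewrite -[LHS](card_ord_ltn (ltnW (ltn_ord j))); apply: eq_card => k.
by rewrite !inE (mono_ltE mono_l).
Qed.

Lemma closer_pos (i : 'I_n) : i + #|[set j : 'I_n | b (inl j) < b (inr i)]| = b (inr i).
Proof.
rewrite -[RHS]label_count addnC; congr addn.
rewrite -[LHS](card_ord_ltn (ltnW (ltn_ord i))); apply: eq_card => k.
by rewrite !inE (mono_ltE mono_r).
Qed.

Lemma outer_cells_up c d : d \in outer_cells -> cell_ge c d -> c \in outer_cells.
Proof.
case: c d => [i j] [i' j']; rewrite !inE /cell_ge /= => h /andP[].
rewrite leq_eqVlt => /orP[/eqP/val_inj->|/mono_r h1];
rewrite leq_eqVlt => /orP[/eqP/val_inj<-|/mono_l h2] //; lia.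
Qed.

Lemma outer_cells_closed : smoothing_closed 1%g outer_cells.
Proof.
split=> [|c d dE _ cd]; last exact: outer_cells_up dE cd.
apply/subsetP => -[i j]; rewrite !inE /= invg1 !perm1 => h.
suff : i < j by move->.
by rewrite -(mono_ltE mono_l); exact: ltn_trans h.
Qed.

(** The cell that a walk enters from [e] is above the path; the condition is vacuous on the left and
    top boundary, where no cell is entered. *)
Definition outer_edge (e : edge n) : Prop :=
  match e with
  | inl (x, j) => forall i : 'I_n, x = i.+1 :> nat -> (i, j) \in outer_cells
  | inr (i, y) => forall j : 'I_n, y = j :> nat -> (i, j) \in outer_cells
  end.

(* Above the Dyck path every cell is an elbow, and elbows preserve positions. *)
Lemma exit_outer e : outer_edge e -> exit outer_cells e = edge_pos e :> nat.
Proof.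
elim/edge_ind: e => [e be _|[i j] IHl IHt].
  by rewrite exit_on_boundary // edge_pos_boundary.
split=> [/(_ i) h|/(_ j) h].
  have cE : (i, j) \in outer_cells by apply: h; rewrite lift0.
  rewrite exit_right cE IHt /=; first by rewrite /bump /=; lia.
  move=> k; rewrite /bump /= => e; apply: outer_cells_up cE _.
  by rewrite /cell_ge /=; lia.
have cE : (i, j) \in outer_cells by apply: h.
rewrite exit_bottom cE IHl //= => k e; apply: outer_cells_up cE _.
by rewrite /cell_ge /=; lia.
Qed.

(** The walk of row [j] is straight below the Dyck path and meets it at abscissa the number of
    closers before the opener [b (inl j)]. The position of that edge is [b (inl j)], and the elbows
    beyond preserve it; columns are similar. *)
Lemma source_exit_outer : source_exit outer_cells =1 b.
Proof.
move=> [j|i]; apply: val_inj => /=.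
  have seg := @initial_segment _ [set i : 'I_n | b (inr i) < b (inl j)].
  have an : #|[set i : 'I_n | b (inr i) < b (inl j)]| < n.+1.
    by rewrite ltnS -[X in _ <= X]card_ord max_card.
  have {}seg i : ((i, j) \in outer_cells) = (i < Ordinal an).
    rewrite -seg ?inE // => i' k ik; rewrite !inE.
    move: ik; rewrite leq_eqVlt => /orP[/eqP/val_inj->//|/mono_r]; lia.
  rewrite -(@exit_row _ _ _ (Ordinal an)) => [|i]; last by rewrite seg -leqNgt.
  rewrite exit_outer /= ?opener_pos // => i e.
  by rewrite seg /= e.
have seg := @initial_segment _ [set j : 'I_n | b (inl j) < b (inr i)].
have an : #|[set j : 'I_n | b (inl j) < b (inr i)]| < n.+1.
    by rewrite ltnS -[X in _ <= X]card_ord max_card.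
have {}seg j : ((i, j) \in outer_cells) = ~~ (j < Ordinal an).
  rewrite -seg ?inE.
    rewrite -leqNgt [RHS]leq_eqVlt orb_idl //= => /eqP/val_inj/inj_b.
    by [].
  move=> j' k jk; rewrite !inE.
  move: jk; rewrite leq_eqVlt => /orP[/eqP/val_inj->//|/mono_l]; lia.
rewrite -(@exit_col _ _ _ (Ordinal an)) => [|j]; last by rewrite seg negbK.
rewrite exit_outer /= ?closer_pos // => j e.
by rewrite seg /= e ltnn.
Qed.

Lemma outer_grid_inv : grid_inv 1%g outer_cells.
Proof.
split; first exact: outer_cells_closed.
by move=> u v; rewrite !source_exit_outer => /inj_b.
Qed.

Lemma Delta_nonnesting_expansion (C : fieldType) :
  (Delta C (arcs b) =
   \sum_(t | leaf 1%g outer_cells t) Delta C (matching_of_perm t))%R.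
Proof.
rewrite -(strand_prod_expansion C outer_grid_inv) Delta_arcs //.
by apply: eq_bigr => i _; rewrite /= !source_exit_outer perm1.
Qed.

End NonnestingGrid.

(** * Dyck paths *)

Section Dyck.

Variable n : nat.
Implicit Types (P Q : (n + n).-tuple bool) (e : 'I_n -> 'I_(n + n)) (s : {perm 'I_n}).

(* [e i] is the position of the [i]-th east step of [P]. *)
Definition east_steps P e : Prop :=
  (forall i k : 'I_n, i < k -> e i < e k) /\
  (forall k, ~~ tnth P k <-> exists i, k = e i).

Lemma east_steps_inj P e : east_steps P e -> injective e.
Proof.
case=> me _ i k ek; apply: val_inj => /=.
by have [/me|/me|//] := ltngtP i k; rewrite ek ltnn.
Qed.

Lemma count_id_negb (r : seq bool) : count id r + count negb r = size r.
Proof. exact: count_predC. Qed.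

Lemma count_east P e k : east_steps P e -> k <= n + n ->
  count negb (take k P) = #|[set i | e i < k]|.
Proof.
move=> ePe; have inj_e := east_steps_inj ePe; case: ePe => _ eP.
elim: k => [_|k IHk kn].
  rewrite take0 /=; symmetry; apply/eqP; rewrite cards_eq0.
  by apply/eqP/setP => i; rewrite !inE.
rewrite (take_nth false) ?size_tuple // -cats1 count_cat IHk ?(ltnW kn) //= addn0.
have -> : nth false P k = tnth P (Ordinal kn) by rewrite (tnth_nth false).
case nP : (~~ tnth P (Ordinal kn)).
  have [i0 e0] := (eP _).1 nP.
  have -> : [set i | e i < k.+1] = i0 |: [set i | e i < k].
    apply/setP => i; rewrite !inE ltnS leq_eqVlt; congr (_ || _).
    apply/eqP/eqP => [h|->]; last by rewrite -e0.
    by apply: inj_e; rewrite -e0; apply: val_inj.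
  by rewrite cardsU1 inE -e0 /= ltnn addnC.
rewrite addn0; congr #|pred_of_set _|; apply/setP => i.
rewrite !inE [RHS]ltnS [RHS]leq_eqVlt.
case: eqP => //= h; move/negbT/negP: nP; case; apply/eP.
by exists i; apply: val_inj; rewrite /= h.
Qed.

Lemma card_east P e i : east_steps P e -> #|[set k | e k < e i]| = i.
Proof.
case=> me _; rewrite -[RHS](card_ord_ltn (ltnW (ltn_ord i))); apply: eq_card => k.
by rewrite !inE (mono_ltE me).
Qed.

(** The east step of index [i] sits at position [e i] after [i] other east steps, so its height is
    [e i - i]. *)
Lemma region_belowP P e (c : cell n) : east_steps P e ->
  (c \in region_below P) = (c.1 + c.2 < e c.1).
Proof.
move=> ePe; rewrite inE; have [me eP] := ePe.
have cnt i : count negb (take (e i) P) = i.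
  by rewrite (count_east ePe) ?(card_east _ ePe) // ltnW.
have cnt' i : count id (take (e i) P) = e i - i.
  have := count_id_negb (take (e i) P); rewrite cnt size_takel; first by lia.
  by rewrite size_tuple ltnW.
apply/existsP/idP => [[k /and3P[/eP[i ->]]]|h].
  by rewrite cnt cnt' => /eqP/val_inj-> ; lia.
exists (e c.1); rewrite cnt cnt' eqxx; apply/and3P; split=> //; last by lia.
by apply/eP; exists c.1.
Qed.

Lemma east_steps_count P e : east_steps P e -> count id P = n.
Proof.
move=> ePe; have := count_id_negb P; rewrite size_tuple.
rewrite -[X in _ + count negb X](take_oversize (n := n + n)) ?size_tuple //.
rewrite (count_east ePe) //.
have -> : [set i | e i < n + n] = setT by apply/setP => i; rewrite !inE ltn_ord.
by rewrite cardsT card_ord; lia.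
Qed.

Lemma east_steps_dyck P e : east_steps P e -> (forall i : 'I_n, 2 * i < e i) -> is_dyck P.
Proof.
move=> ePe he; rewrite /is_dyck (east_steps_count ePe) eqxx.
apply/forallP => k; have kn : k <= n + n by rewrite -ltnS.
have := count_id_negb (take k P); rewrite size_takel ?size_tuple //.
rewrite (count_east ePe) //; set m := #|_| => h.
suff : 2 * m <= k by lia.
case em : m => [//|m'].
have mn : m' < n by rewrite -em -[X in _ <= X]card_ord max_card.
have : Ordinal mn \in [set i | e i < k].
  rewrite initial_segment -/m ?em //= => i l il; rewrite !inE.
  by move: il; rewrite leq_eqVlt => /orP[/eqP/val_inj->//|]; case: ePe => me _ /me; lia.
by rewrite inE => lt; have := he (Ordinal mn); rewrite /=; lia.
Qed.

Lemma dyck_east_steps P : is_dyck P -> exists e, east_steps P e.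
Proof.
case/andP => /eqP cP _; have := count_id_negb P; rewrite cP size_tuple => cN.
have cA : #|[set k | ~~ tnth P k]| = n.
  transitivity (count negb P); last by lia.
  rewrite cardE /enum_mem size_filter -enumT -[in RHS](map_tnth_enum P) count_map.
  by apply: eq_count => k; rewrite /= inE.
have [e [me eA]] := increasing_enum cA; exists e; split=> // k.
by rewrite -eA inE.
Qed.

Section MinimumPath.

Variable s : {perm 'I_n}.

(** Heights of a path weakly increase from left to right, so above column [i] it must clear the
    marks of all columns up to [i]. *)
Definition min_height (i : 'I_n) : nat := \max_(k : 'I_n | k <= i) (s k).+1.

Lemma min_height_ge (i k : 'I_n) : k <= i -> s k < min_height i.
Proof. by move=> ki; rewrite /min_height (bigD1 k) //= leq_max leqnn. Qed.

Lemma min_height_le (i : 'I_n) m :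
  (forall k : 'I_n, k <= i -> s k < m) -> min_height i <= m.
Proof. by move=> h; apply/bigmax_leqP => k /h. Qed.

Lemma min_height_le_n i : min_height i <= n.
Proof. exact: min_height_le. Qed.

Lemma min_east_subproof (i : 'I_n) : i + min_height i < n + n.
Proof. by have := ltn_ord i; have := min_height_le_n i; lia. Qed.

Definition min_east i : 'I_(n + n) := Ordinal (min_east_subproof i).

Definition min_path : (n + n).-tuple bool :=
  [tuple [forall i, k != min_east i] | k < n + n].

Lemma min_path_east : east_steps min_path min_east.
Proof.
split=> [i k ik /=|k].
  suff : min_height i <= min_height k by lia.
  by apply: min_height_le => l li; apply: min_height_ge; lia.
rewrite tnth_mktuple negb_forall; split=> [|[i ->]].
  by case/existsP => i; rewrite negbK => /eqP; exists i.
by apply/existsP; exists i; rewrite negbK.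
Qed.

(** The [i + 1] marks of the columns up to [i] occupy distinct rows below this height; this keeps
    the minimum path above the diagonal. *)
Lemma min_height_gt (i : 'I_n) : i < min_height i.
Proof.
rewrite -(card_ord_ltn (min_height_le_n i)) -[X in X <= _](card_ord_ltn (ltn_ord i)).
rewrite -(card_imset _ (@perm_inj _ s)); apply/subset_leq_card/subsetP => _ /imsetP[k + ->].
by rewrite !inE ltnS => /min_height_ge.
Qed.

Lemma min_path_covers : dyck_covers s min_path.
Proof.
rewrite /dyck_covers (east_steps_dyck min_path_east) => [|i] /=.
  apply/forallP => i; rewrite (region_belowP _ min_path_east) /=.
  by rewrite ltn_add2l min_height_ge.
by have := min_height_gt i; lia.
Qed.

Lemma min_path_sub Q : is_dyck Q -> (forall i, (i, s i) \in region_below Q) ->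
  dyck_sub min_path Q.
Proof.
move=> /dyck_east_steps[e eQ] cov; apply/subsetP => -[i j].
rewrite (region_belowP _ min_path_east) (region_belowP _ eQ) /= => h.
suff : min_height i <= e i - i by lia.
apply: min_height_le => k ki; have := cov k; rewrite (region_belowP _ eQ) /=.
(* The heights [e i - i] of [Q] weakly increase, since successive east steps are at least one
   position apart. *)
suff : e k + (i - k) <= e i by lia.
have [me _] := eQ; case: i ki {h} => i iN /=; elim: i iN => [|i IHi] iN ki.
  by rewrite sub0n addn0; have -> : k = Ordinal iN by apply: val_inj => /=; lia.
have [ki'|ki'|ki'] := ltngtP k i.+1; last 2 first.
- lia.
- by have -> : k = Ordinal iN by [exact: val_inj]; rewrite /= subnn addn0.
have := me (Ordinal (ltnW iN)) (Ordinal iN) (ltnSn _).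
by have := IHi (ltnW iN) ki'; rewrite /=; lia.
Qed.

End MinimumPath.

Lemma dyck_of_permP s Q : is_dyck Q ->
  dyck_sub (dyck_of_perm s) Q = [forall i, (i, s i) \in region_below Q].
Proof.
move=> dQ; rewrite /dyck_of_perm; case: pickP => [P /andP[cP minP]|none]; last first.
  case/negP: (none (min_path s)); rewrite min_path_covers /=.
  apply/forallP => Q'; apply/implyP => /andP[dQ' /forallP]; exact: min_path_sub.
apply/idP/forallP => [/subsetP sub i|cov] /=.
  by apply: sub; case/andP: cP => _ /forallP.
by move/forallP/(_ Q)/implyP: minP; apply; rewrite /dyck_covers dQ; apply/forallP.
Qed.

Section DyckOfMatching.

Variable b : 'I_n + 'I_n -> 'I_(n + n).
Hypotheses (inj_b : injective b) (lt_b : forall i, b (inl i) < b (inr i)).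
Hypothesis mono_l : forall i k : 'I_n, i < k -> b (inl i) < b (inl k).
Hypothesis mono_r : forall i k : 'I_n, i < k -> b (inr i) < b (inr k).

Lemma arcs_east_steps : east_steps (dyck_of_matching (arcs b)) (fun i => b (inr i)).
Proof.
split=> // k; rewrite tnth_mktuple.
have [b' bK b'K] : bijective b by apply: inj_card_bij => //; rewrite card_sum !card_ord.
split=> [/negP h|[i ->]]; last first.
  by apply/negP => /(opener_arcs _ inj_b lt_b)[k' /inj_b].
case e : (b' k) => [i|i]; last by exists i; rewrite -e b'K.
by case: h; apply/opener_arcs => //; exists i; rewrite -e b'K.
Qed.

Lemma region_below_arcs : region_below (dyck_of_matching (arcs b)) = ~: outer_cells b.
Proof.
apply/setP => -[i j]; rewrite (region_belowP _ arcs_east_steps) !inE /=.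
have := closer_pos inj_b mono_r i => cl.
rewrite -[X in _ < X]cl ltn_add2l -leqNgt [RHS]leq_eqVlt.
have -> : (b (inl j) == b (inr i) :> nat) = false by apply/eqP => /val_inj/inj_b.
rewrite /= -initial_segment ?inE // => k l kl; rewrite !inE.
by move: kl; rewrite leq_eqVlt => /orP[/eqP/val_inj->//|/mono_l]; lia.
Qed.

Lemma arcs_dyck : is_dyck (dyck_of_matching (arcs b)).
Proof.
apply: (east_steps_dyck arcs_east_steps) => i; rewrite -(closer_pos inj_b mono_r i).
suff : i < #|[set j : 'I_n | b (inl j) < b (inr i)]| by lia.
rewrite -[X in X <= _](card_ord_ltn (ltn_ord i)); apply/subset_leq_card/subsetP => k.
rewrite !inE ltnS leq_eqVlt => /orP[/eqP/val_inj->//|/mono_l h].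
exact: ltn_trans h (lt_b i).
Qed.

Lemma web_perm_below s :
  web_perm s && dyck_sub (dyck_of_perm s) (dyck_of_matching (arcs b)) =
  leaf 1%g (outer_cells b) s.
Proof.
(* The leaves from [set0] are all the web permutations; the outer cells select those with every mark
   below the path. *)
rewrite (@leaf_smoothing_closed _ _ set0); first last.
- exact: sub0set.
- exact: outer_cells_closed.
- by split=> [|c d]; rewrite ?sub0set ?inE.
rewrite dyck_of_permP ?arcs_dyck //; congr (_ && _); apply: eq_forallb => i.
by rewrite region_below_arcs in_setC.
Qed.

End DyckOfMatching.

End Dyck.

(** * Specht and web modules *)

Section Tableaux.

Variable n : nat.
Implicit Types (b : 'I_n + 'I_n -> 'I_(n + n)) (T : 'M['I_(n + n)]_(2, n)).

(* The two rows of a standard tableau, openers first. *)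
Definition standard_ends b : Prop :=
  [/\ injective b, forall i, b (inl i) < b (inr i),
      forall i k : 'I_n, i < k -> b (inl i) < b (inl k) &
      forall i k : 'I_n, i < k -> b (inr i) < b (inr k)].

Definition tableau_of b : 'M['I_(n + n)]_(2, n) :=
  \matrix_(r, j) if r == ord0 then b (inl j) else b (inr j).

Definition ends_of T (u : 'I_n + 'I_n) : 'I_(n + n) :=
  match u with inl j => T ord0 j | inr j => T ord_max j end.

Lemma ord2P (r : 'I_2) : r = ord0 \/ r = ord_max.
Proof. by case: r => [[|[|r]] hr]; [left|right|]; try apply: val_inj. Qed.

Lemma tableau_ofK b : ends_of (tableau_of b) =1 b.
Proof. by case=> j; rewrite /= mxE. Qed.

Lemma matching_of_tableauE T : matching_of_tableau T = arcs (ends_of T).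
Proof.
apply: eq_imset => j; apply/setP => p; rewrite !inE; apply/imsetP/idP.
  by case=> r _ ->; case: (ord2P r) => ->; rewrite eqxx ?orbT.
by case/orP => /eqP->; [exists ord0|exists ord_max].
Qed.

Lemma is_standardP T : reflect (standard_ends (ends_of T)) (is_standard T).
Proof.
apply: (iffP and3P) => [[/injectiveP injT /forallP rowT /forallP colT]|[injb ltb ml mr]].
  split=> //.
  - move=> [i|i] [k|k] /= e.
    + by have := injT (ord0, i) (ord0, k) e => -[->].
    + by have := injT (ord0, i) (ord_max, k) e.
    + by have := injT (ord_max, i) (ord0, k) e.
    + by have := injT (ord_max, i) (ord_max, k) e => -[->].
  - by move=> i k; have /forallP/(_ i)/forallP/(_ k)/implyP := rowT ord0.
  - by move=> i k; have /forallP/(_ i)/forallP/(_ k)/implyP := rowT ord_max.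
split.
- apply/injectiveP => -[r j] [r' j'] /=.
  by case: (ord2P r) => ->; case: (ord2P r') => -> e;
    [have := injb (inl j) (inl j') e|have := injb (inl j) (inr j') e
    |have := injb (inr j) (inl j') e|have := injb (inr j) (inr j') e] => // -[->].
- apply/forallP => r; apply/forallP => j; apply/forallP => k; apply/implyP.
  by case: (ord2P r) => ->; [exact: ml|exact: mr].
- by apply/forallP.
Qed.

Lemma arcs_nonnesting b : standard_ends b -> nonnesting (arcs b).
Proof.
move=> [inj_b lt_b mono_l mono_r]; rewrite /nonnesting arcs_matching //=.
apply/negP => /existsP[p /existsP[q /existsP[q' /existsP[p' /and5P[pq qq' q'p' pM qM]]]]].
have ends (x y : 'I_(n + n)) : x < y -> [set x; y] \in arcs b ->
    exists i, x = b (inl i) /\ y = b (inr i).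
  move=> xy /(arcsP inj_b); case=> [|i [[-> ->]|[ex ey]]]; last 2 first.
  - by exists i.
  - by move: xy; rewrite ex ey; have := lt_b i; lia.
  - by apply/eqP => e; rewrite e ltnn in xy.
have [i [ep ep']] := ends _ _ (ltn_trans pq (ltn_trans qq' q'p')) pM.
have [k [eq eq']] := ends _ _ qq' qM.
subst; move: pq q'p'; rewrite (mono_ltE mono_l) (mono_ltE mono_r); lia.
Qed.

(** When arcs are listed by increasing openers, a descent among the closers would nest two of
    them. *)
Lemma nonnesting_arcs (M : matching n) : nonnesting M ->
  exists b, standard_ends b /\ M = arcs b.
Proof.
case/andP => mM /negP nn; have [b [inj_b lt_b mono_l eM]] := matching_arcs mM.
exists b; split=> //; split=> // i k ik.
have [//|h|/val_inj/inj_b[e]] := ltngtP (b (inr i)) (b (inr k)); last first.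
  by rewrite e ltnn in ik.
case: nn; apply/existsP; exists (b (inl i)); apply/existsP; exists (b (inl k)).
apply/existsP; exists (b (inr k)); apply/existsP; exists (b (inr i)).
rewrite mono_l //= lt_b h eM /=.
by apply/andP; split; exact: imset_f.
Qed.

Lemma matching0_nonnesting : nonnesting (matching0 n).
Proof.
have lt0 (i : 'I_n) : 2 * i < n + n by have := ltn_ord i; lia.
have lt1 (i : 'I_n) : (2 * i).+1 < n + n by have := ltn_ord i; lia.
pose b (u : 'I_n + 'I_n) : 'I_(n + n) :=
  match u with inl i => Ordinal (lt0 i) | inr i => Ordinal (lt1 i) end.
suff -> : matching0 n = arcs b.
  apply: arcs_nonnesting; split=> [[i|i] [k|k] /(congr1 val) /= e|i /=|i k /=|i k /=]; try lia.
    by congr inl; apply: val_inj => /=; lia.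
  by congr inr; apply: val_inj => /=; lia.
apply/setP => B; rewrite inE; apply/existsP/imsetP.
  case=> p /existsP[q /and3P[ep /eqP eq /eqP->]].
  have hi : p./2 < n by have := ltn_ord p; lia.
  exists (Ordinal hi) => //.
  by congr [set _; _]; apply: val_inj => /=; lia.
case=> i _ ->; exists (b (inl i)); apply/existsP; exists (b (inr i)); apply/and3P; split; rewrite //=; lia.
Qed.

End Tableaux.

Section Specht.

Variables (C : fieldType) (n : nat).
Implicit Types (s : {perm 'I_(n + n)}) (b : 'I_n + 'I_n -> 'I_(n + n)).
Implicit Types (T : 'M['I_(n + n)]_(2, n)) (M : matching n).
Local Open Scope ring_scope.

Lemma specht_vec_nonnesting M : nonnesting M -> exists b,
  [/\ standard_ends b, M = arcs b & specht_vec C M = polytabloid C (tableau_of b)].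
Proof.
case/nonnesting_arcs => b [sb eM]; rewrite /specht_vec.
case: pickP => [T /andP[/is_standardP sT /eqP eT]|/(_ (tableau_of b))/negP[]].
  exists (ends_of T); split; rewrite -?matching_of_tableauE //.
  congr polytabloid; apply/matrixP => r j; rewrite mxE.
  by case: (ord2P r) => ->.
have e : ends_of (tableau_of b) = b by apply: boolp.funext; exact: tableau_ofK.
apply/andP; split; first by apply/is_standardP; rewrite e.
by rewrite matching_of_tableauE e eM.
Qed.

Lemma space_act_linear s (v w : tabloid_space C n) (a : C) :
  space_act s (a *: v + w) = a *: space_act s v + space_act s w.
Proof.
rewrite /space_act scaler_sumr -big_split; apply: eq_bigr => t _ /=.
by rewrite !ffunE scalerDl scalerA.
Qed.

Lemma space_act_sum (I : finType) (A : {set I}) s (a : I -> C)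
    (v : I -> tabloid_space C n) :
  space_act s (\sum_(i in A) a i *: v i) = \sum_(i in A) a i *: space_act s (v i).
Proof.
elim/big_rec2: _ => [|i w w' _ <-]; last by rewrite space_act_linear.
by rewrite /space_act big1 // => t _; rewrite ffunE scale0r.
Qed.

Lemma space_act_tabloid s (t : tabloid n) :
  space_act s (tabloid_vec C t) = tabloid_vec C (tabloid_act s t).
Proof.
rewrite /space_act (bigD1 t) //= ffunE eqxx scale1r big1 ?addr0 // => u ut.
by rewrite ffunE (negPf ut) scale0r.
Qed.

Lemma column_stab_map s (q : {perm 'I_(n + n)}) T :
  (q ^ s \in column_stab (map_mx s T))%g = (q \in column_stab T).
Proof.
rewrite !inE; apply: eq_forallb => j.
have -> : [set map_mx s T r j | r : 'I_2] = s @: [set T r j | r : 'I_2].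
  by rewrite -imset_comp; apply: eq_imset => r; rewrite mxE.
set A := [set T r j | r : 'I_2].
have -> : ((q ^ s)%g @: (s @: A)) = s @: (q @: A).
  by rewrite -!imset_comp; apply: eq_imset => p /=; rewrite permJ.
by rewrite (inj_eq (imset_inj (@perm_inj _ s))).
Qed.

(** Conjugation by [s] carries the column stabilizer of [T] to that of the relabelled tableau and
    preserves signs. *)
Lemma polytabloid_map s T :
  polytabloid C (map_mx s T) = space_act s (polytabloid C T).
Proof.
rewrite /polytabloid space_act_sum (reindex_inj (conjg_inj s)) /=.
apply: eq_big => q; first exact: column_stab_map.
move=> _; rewrite odd_permJ space_act_tabloid; congr (_ *: tabloid_vec C _).
apply/ffunP => r; rewrite !ffunE -imset_comp; apply: eq_imset => j /=.
by rewrite !mxE permJ.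
Qed.

Lemma web_act_Delta_arc s i j :
  web_act s (Delta_arc C i j) = Delta_arc C (s i) (s j).
Proof.
have z r k : web_act s (zmat C n r k) = zmat C n r (s k).
  by rewrite /web_act [zmat C n r k]mxE comp_mpolyXU -tnth_nth tnth_mktuple mxvecE !mxE.
by rewrite /web_act /Delta_arc raddfB /= !rmorphM /= -!/(web_act _ _) !z.
Qed.

Lemma web_act_Delta_arcs s b b' : standard_ends b -> standard_ends b' ->
    (forall u, s (b u) = b' u) ->
  web_act s (Delta C (arcs b)) = Delta C (arcs b').
Proof.
move=> [inj_b lt_b _ _] [inj_b' lt_b' _ _] sb; rewrite !Delta_arcs //.
rewrite /web_act rmorph_prod; apply: eq_bigr => i _ /=.
by rewrite -/(web_act _ _) web_act_Delta_arc !sb.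
Qed.

Lemma in_web_module0 : in_web_module (0 : web_ring C n).
Proof. by exists (fun=> 0); rewrite big1 // => M _; rewrite scale0r. Qed.

Lemma in_web_module_linear (a : C) (p q : web_ring C n) :
  in_web_module p -> in_web_module q -> in_web_module (a *: p + q).
Proof.
move=> [c ->] [d ->]; exists (fun M => a * c M + d M).
rewrite scaler_sumr -big_split; apply: eq_bigr => M _ /=.
by rewrite scalerDl scalerA.
Qed.

Lemma in_web_module_Delta M : is_matching M -> in_web_module (Delta C M).
Proof.
move=> mM; exists (fun M' => (M' == M)%:R).
rewrite (bigD1 M) //= eqxx scale1r big1 ?addr0 // => M' /andP[_ /negPf->].
by rewrite scale0r.
Qed.

Variable phi : web_ring C n -> tabloid_space C n.
Hypothesis phi_iso : is_web_specht_iso phi.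

Lemma web_iso0 : phi 0 = 0.
Proof.
(* Linearity is only given in the form [c *: p + q]; taking [c = -1] and [p = q = 0] yields the
   value at 0. *)
have := iso_linear phi_iso (-1) in_web_module0 in_web_module0.
by rewrite scaler0 addr0 scaleN1r addNr.
Qed.

Lemma web_iso_sum (P : pred (matching n)) (c : matching n -> C) :
    (forall M, P M -> is_matching M) ->
  in_web_module (\sum_(M | P M) c M *: Delta C M) /\
  phi (\sum_(M | P M) c M *: Delta C M) = \sum_(M | P M) c M *: phi (Delta C M).
Proof.
move=> mP; elim/big_rec2: _ => [|M v w PM [ww ew]].
  by rewrite web_iso0; split=> //; exact: in_web_module0.
have wM := in_web_module_Delta (mP _ PM).
split; first exact: in_web_module_linear.
by rewrite (iso_linear phi_iso) // ew.
Qed.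

(* Both sides are the image of [v_(M_0) = phi Delta_(M_0)] under a permutation
   carrying the standard tableau of [M_0] to that of [M]. *)
Lemma specht_vec_web M : nonnesting M -> specht_vec C M = phi (Delta C M).
Proof.
move=> /specht_vec_nonnesting[b [sb eM ->]].
have [b0 [sb0 eM0 e0]] := specht_vec_nonnesting (matching0_nonnesting n).
have [inj_b _ _ _] := sb; have [inj_b0 _ _ _] := sb0.
have [b0' b0K b0'K] : bijective b0 by apply: inj_card_bij => //; rewrite card_sum !card_ord.
have inj_s : injective (b \o b0') by apply: inj_comp => //; exact: can_inj b0'K.
(* [s] sends openers to openers and closers to closers, arc by arc, so no sign appears in its action
   on the product. *)
pose s := perm inj_s.
have sE u : s (b0 u) = b u by rewrite permE /= b0K.
have w0 : in_web_module (Delta C (matching0 n)).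
  by apply: in_web_module_Delta; case/andP: (matching0_nonnesting n).
rewrite eM -(web_act_Delta_arcs sb0 sb sE) -eM0 (iso_equivariant phi_iso) //.
rewrite (iso_normalized phi_iso) e0 -polytabloid_map; congr polytabloid.
by apply/matrixP => r j; rewrite !mxE; case: ifP => _; rewrite sE.
Qed.

End Specht.

Theorem theorem1p2 (R : realType) (n : nat) (n_gt0 : 0 < n)
    (phi : web_ring R[i] n -> tabloid_space R[i] n)
    (phi_iso : is_web_specht_iso phi)
    (a : matching n -> matching n -> R[i])
    (a_transition : forall M : matching n, nonnesting M ->
       specht_vec R[i] M =
       (\sum_(M' : matching n | noncrossing M') a M M' *: phi (Delta R[i] M'))%R)
    (M M' : matching n) (M_nonnesting : nonnesting M)
    (M'_noncrossing : noncrossing M') :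
  a M M' =
  (#|[set s : {perm 'I_n} | [&& web_perm s,
       dyck_sub (dyck_of_perm s) (dyck_of_matching M) &
       matching_of_perm s == M']]|)%:R%R.
Proof.
have [b [[inj_b lt_b mono_l mono_r] eM]] := nonnesting_arcs M_nonnesting.
pose N (M1 : matching n) := #|[set s : {perm 'I_n} | [&& web_perm s,
  dyck_sub (dyck_of_perm s) (dyck_of_matching M) & matching_of_perm s == M1]]|.
have expand : Delta R[i] M = (\sum_(M1 | noncrossing M1) (N M1)%:R *: Delta R[i] M1)%R.
  rewrite eM (Delta_nonnesting_expansion inj_b lt_b mono_l mono_r).
  rewrite (partition_big (@matching_of_perm n) (@noncrossing n)) /= => [|s lf]; last first.
    apply: noncrossing_matching_of_perm; apply: grid_inv_leaf lf.
    exact: outer_grid_inv.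
  apply: eq_bigr => M1 _; rewrite (eq_bigr (fun=> Delta R[i] M1)); last first.
    by move=> s /andP[_ /eqP->].
  rewrite sumr_const scaler_nat; congr (_ *+ _)%R; apply: eq_card => s.
  by rewrite !inE eM andbA web_perm_below.
have ncm (M1 : matching n) : noncrossing M1 -> is_matching M1 by case/andP.
have [wa ea] := web_iso_sum phi_iso (a M) ncm.
have [wN eN] := web_iso_sum phi_iso (fun M1 => (N M1)%:R%R) ncm.
have := a_transition M M_nonnesting.
rewrite (specht_vec_web phi_iso M_nonnesting) {1}expand -ea.
(* [a] is known only through the expansion of [v_M]. Injectivity of [phi] brings that expansion back
   to polynomials, where independence identifies its coefficients with the counts [N]. *)
move/(iso_inj phi_iso wN wa)/esym/eqP; rewrite -subr_eq0 -sumrB => /eqP H.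
apply/eqP; rewrite -subr_eq0; apply/eqP.
apply: (Delta_noncrossing_free (c := fun M1 => (a M M1 - (N M1)%:R)%R)) M'_noncrossing.
by rewrite -[RHS]H; apply: eq_bigr => M1 _; rewrite scalerBl.
Qed.
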